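(* Let $(M,\cdot,\tilde g,E)$ be a weak $\mathfrak{F}$-manifold with $L_E(\tilde g)=D\tilde g$ and $L_E(\cdot)=k\,\cdot$, and let $g$ be the metric on $M$ defined by $g^*\tilde g=E\cdot$ (i.e. $g^*(\tilde g(X))=E\cdot X$). Let $N$ be a submanifold of $M$ such that (1) $X\cdot Y\in TN$ for every $X,Y\in TN$; (2) $E\cdot TN\subset TN$. Assume that $g^*+\lambda\tilde g^*$ is non-degenerate for every constant $\lambda$, and that the metrics $h,\tilde h$ induced on $N$ by $g,\tilde g$, as well as $h_\lambda^*=h^*+\lambda\tilde h^*$ for every constant $\lambda$, are non-degenerate. Then the metrics $h$ and $\tilde h$ induced by $g$ and $\tilde g$ on $N$ are compatible.
   Context: Notation. $\mathcal{X}(M)$: smooth vector fields on $M$. ''Metric'' means pseudo-Riemannian metric. For a metric $g$, $g^*$ is the induced metric on $T^*M$; also $g(X)=g(X,\cdot)$ and $g^*\alpha$ is the vector field dual to the $1$-form $\alpha$. $\nabla$ ($\tilde\nabla$) is the Levi-Civita connection of $g$ ($\tilde g$), also on $T^*M$; $R_{X,Y}=\nabla_X\nabla_Y-\nabla_Y\nabla_X-\nabla_{[X,Y]}$. $E$ need not be tangent to $N$ along $N$. Compatibility of two metrics $h,\tilde h$ on a manifold $N$: for every constant $\lambda$ let $h_\lambda$ be the metric with $h_\lambda^*:=h^*+\lambda\tilde h^*$. With $D,\tilde D,D^\lambda$ the Levi-Civita connections and $R,\tilde R,R^\lambda$ the curvatures of $h,\tilde h,h_\lambda$, the metrics $h,\tilde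 h$ are almost compatible if $h_\lambda^*D^\lambda_X\alpha=h^*D_X\alpha+\lambda\tilde h^*\tilde D_X\alpha$ for all vector fields $X$, $1$-forms $\alpha$ on $N$ and constants $\lambda$; compatible if moreover $h_\lambda^*(R^\lambda_{X,Y}\alpha)=h^*(R_{X,Y}\alpha)+\lambda\tilde h^*(\tilde R_{X,Y}\alpha)$ for all $X,Y,\alpha,\lambda$. Weak $\mathfrak{F}$-manifold: a manifold $M$ with a multiplication $\cdot$ on $TM$ (a bundle map, bilinear on fibres), a vector field $E$ (the Euler field) and a metric $\tilde g$ such that (1) $\cdot$ is associative, commutative, with unity $e$; (2) $E$ has an inverse $E^{-1}$ with respect to $\cdot$, satisfies $L_E(\cdot)=k\,\cdot$ (i.e. $[E,X\cdot Y]-[E,X]\cdot Y-X\cdot[E,Y]=kX\cdot Y$) and $L_E(\tilde g)=D\tilde g$ for constants $k,D$, and the operator $T(u):=\frac{D+k}{2}u-\tilde g(\tilde\nabla_{\tilde g^*(u)}E)$ is an automorphism of $T^*M$; (3) $\tilde g(X\cdot Y,Z)=\tilde g(X,Y\cdot Z)$ for all $X,Y,Z\in\mathcal{X}(M)$; (4) $\tilde\nabla(\cdot)(X,Y,Z,E)=\tilde\nabla(\cdot)(E,X,Y,Z)$ for all $X,Y,Z\in\mathcal{X}(M)$, where $\tilde\nabla(\cdot)(X,Y,Z,V):=\tilde g(\tilde\nabla_X(\cdot)(Y,Z),V)$ and $\tilde\nabla_X(\cdot)(Y,Z)=\tilde\nabla_X(Y\cdot Z)-\tilde\nabla_X(Y)\cdot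 Z-Y\cdot\tilde\nabla_X(Z)$. *)

(* Defs.v *)
(* MathComp-Analysis: smooth manifolds, tensor fields and Levi-Civita
   connections over an arbitrary R : realType. *)
From HB Require Import structures.
From mathcomp Require Import all_boot all_order all_algebra.
From mathcomp Require Import all_classical all_reals all_analysis.
Import Order.TTheory GRing.Theory Num.Theory.
Import numFieldNormedType.Exports.

Set Implicit Arguments.
Unset Strict Implicit.
Unset Printing Implicit Defensive.

Local Open Scope classical_set_scope.
Local Open Scope ring_scope.

Section SmoothFunctions.
Context {R : realType} {V W : normedModType R}.

Fixpoint Ck_on (k : nat) (U : set V) (f : V -> W) : Prop :=
  if k is k'.+1 then
    (forall x, U x -> differentiable f x) /\
    (forall v, Ck_on k' U (fun x => 'd f x v))
  else forall x, U x -> {for x, continuous f}.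

Definition smooth_on (U : set V) (f : V -> W) : Prop := forall k, Ck_on k U f.

End SmoothFunctions.

(* Only the values of chart_fun on chart_dom and of chart_inv on chart_img
   are meaningful. *)
Record chart (R : realType) (n : nat) (M : topologicalType) := Chart {
  chart_dom : set M;
  chart_img : set 'rV[R]_n;
  chart_fun : M -> 'rV[R]_n;
  chart_inv : 'rV[R]_n -> M;
  chart_dom_open : open chart_dom;
  chart_img_open : open chart_img;
  chart_funP : forall x, chart_dom x -> chart_img (chart_fun x);
  chart_invP : forall y, chart_img y -> chart_dom (chart_inv y);
  chart_funK : forall x, chart_dom x -> chart_inv (chart_fun x) = x;
  chart_invK : forall y, chart_img y -> chart_fun (chart_inv y) = y;
  chart_fun_cont : forall x, chart_dom x -> {for x, continuous chart_fun};
  chart_inv_cont : forall y, chart_img y -> {for y, continuous chart_inv}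
}.

(* The atlas need not be maximal.  Each point x has a preferred chart
   chart_at x, through which the tangent space T_x M is identified with
   'rV_n. *)
Record manifold (R : realType) (n : nat) := Manifold {
  carrier :> topologicalType;
  manifold_hausdorff : hausdorff_space carrier;
  manifold_second_countable : @second_countable carrier;
  atlas : set (chart R n carrier);
  chart_at : carrier -> chart R n carrier;
  chart_at_atlas : forall x, atlas (chart_at x);
  chart_at_dom : forall x, chart_dom (chart_at x) x;
  atlas_smooth : forall c c', atlas c -> atlas c' ->
    smooth_on (chart_img c `&` chart_inv c @^-1` chart_dom c')
      (chart_fun c' \o chart_inv c)
}.

Section TensorFields.
Context {R : realType} {n : nat} (M : manifold R n).

(* Row vectors are tangent vectors, column vectors are covectors, and square
   matrices are bilinear forms on a tangent space (Gram matrices), all with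
   respect to the basis of T_x M given by chart_at x. *)
Definition vfield := M -> 'rV[R]_n.
Definition form1 := M -> 'cV[R]_n.
Definition biform := M -> 'M[R]_n.
Definition multiplication := M -> 'rV[R]_n -> 'rV[R]_n -> 'rV[R]_n.

Definition local_coord (x : M) : 'rV[R]_n := chart_fun (chart_at x) x.

(* Matrix of the change of basis of T_x M from chart_at x to c. *)
Definition tcoord (c : chart R n M) (x : M) : 'M[R]_n :=
  jacobian (chart_fun c \o chart_inv (chart_at x)) (local_coord x).

Definition vf_coord (c : chart R n M) (X : vfield) (y : 'rV[R]_n) : 'rV[R]_n :=
  X (chart_inv c y) *m tcoord c (chart_inv c y).

Definition smooth_fun (f : M -> R) : Prop :=
  forall c, atlas c -> smooth_on (chart_img c) (f \o chart_inv c : _ -> R^o).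

Definition smooth_vf (X : vfield) : Prop :=
  forall c, atlas c -> smooth_on (chart_img c) (vf_coord c X).

Definition pair_at (a : 'cV[R]_n) (v : 'rV[R]_n) : R := (v *m a) 0 0.

Definition pairing (a : form1) (X : vfield) : M -> R :=
  fun x => pair_at (a x) (X x).

Definition smooth_form1 (a : form1) : Prop :=
  forall X, smooth_vf X -> smooth_fun (pairing a X).

Definition form_at (G : 'M[R]_n) (u v : 'rV[R]_n) : R := (u *m G *m v^T) 0 0.

Definition eval_form (g : biform) (X Y : vfield) : M -> R :=
  fun x => form_at (g x) (X x) (Y x).

Definition nondegenerate_form (g : biform) : Prop := forall x, g x \in unitmx.

Definition metric (g : biform) : Prop :=
  [/\ forall x, (g x)^T = g x,
      nondegenerate_form g
    & forall X Y, smooth_vf X -> smooth_vf Y -> smooth_fun (eval_form g X Y)].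

Definition lower_at (G : 'M[R]_n) (v : 'rV[R]_n) : 'cV[R]_n := (v *m G)^T.

Definition sharp_at (G : 'M[R]_n) (a : 'cV[R]_n) : 'rV[R]_n := a^T *m invmx G.

Definition lower (g : biform) (X : vfield) : form1 :=
  fun x => lower_at (g x) (X x).

Definition sharp (g : biform) (a : form1) : vfield :=
  fun x => sharp_at (g x) (a x).

(* Gram matrices, in the dual basis, of the metric g^* on the cotangent
   bundle and of g^* + lambda gt^*; the latter is dual to
   pencil g gt lambda. *)
Definition dual_form (g : biform) : biform := fun x => invmx (g x).

Definition dual_pencil (g gt : biform) (lambda : R) : biform :=
  fun x => dual_form g x + lambda *: dual_form gt x.

Definition pencil (g gt : biform) (lambda : R) : biform :=
  fun x => invmx (dual_pencil g gt lambda x).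

Definition vf_deriv (X : vfield) (f : M -> R) : M -> R :=
  fun x => 'D_(X x) (f \o chart_inv (chart_at x) : _ -> R^o) (local_coord x).

(* [X, Y]^i = X^j d_j Y^i - Y^j d_j X^i, in the coordinates of chart_at x. *)
Definition bracket (X Y : vfield) : vfield :=
  fun x => 'D_(X x) (vf_coord (chart_at x) Y) (local_coord x)
         - 'D_(Y x) (vf_coord (chart_at x) X) (local_coord x).

Definition scalev (f : M -> R) (X : vfield) : vfield := fun x => f x *: X x.

(* A covariant derivative on vector fields together with one on 1-forms. *)
Record connection := Connection {
  nabla : vfield -> vfield -> vfield;
  nabla1 : vfield -> form1 -> form1
}.

Record is_connection (D : connection) : Prop := IsConnection {
  nabla_smooth : forall X Y, smooth_vf X -> smooth_vf Y ->
    smooth_vf (nabla D X Y);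
  nabla_linear : forall f X X' Y, smooth_fun f ->
    smooth_vf X -> smooth_vf X' -> smooth_vf Y ->
    nabla D (scalev f X + X') Y =1 scalev f (nabla D X Y) + nabla D X' Y;
  nabla_additive : forall X Y Y', smooth_vf X -> smooth_vf Y -> smooth_vf Y' ->
    nabla D X (Y + Y') =1 nabla D X Y + nabla D X Y';
  nabla_leibniz : forall f X Y, smooth_fun f -> smooth_vf X -> smooth_vf Y ->
    nabla D X (scalev f Y) =1 scalev (vf_deriv X f) Y + scalev f (nabla D X Y);
  nabla1_smooth : forall X a, smooth_vf X -> smooth_form1 a ->
    smooth_form1 (nabla1 D X a);
  nabla1_dual : forall X a Y, smooth_vf X -> smooth_form1 a -> smooth_vf Y ->
    forall x, pairing (nabla1 D X a) Y x
            = vf_deriv X (pairing a Y) x - pairing a (nabla D X Y) x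
}.

Record levi_civita (g : biform) (D : connection) : Prop := LeviCivita {
  lc_connection : is_connection D;
  lc_torsion_free : forall X Y, smooth_vf X -> smooth_vf Y ->
    nabla D X Y - nabla D Y X =1 bracket X Y;
  lc_metric : forall X Y Z, smooth_vf X -> smooth_vf Y -> smooth_vf Z ->
    forall x, vf_deriv X (eval_form g Y Z) x
            = eval_form g (nabla D X Y) Z x + eval_form g Y (nabla D X Z) x
}.

Definition curvature1 (D : connection) (X Y : vfield) (a : form1) : form1 :=
  nabla1 D X (nabla1 D Y a) - nabla1 D Y (nabla1 D X a)
  - nabla1 D (bracket X Y) a.

(* The Levi-Civita connections are quantified universally: each is unique on
   smooth vector fields and smooth 1-forms. *)
Definition almost_compatible (h ht : biform) : Prop :=
  forall (lambda : R) (D Dt Dl : connection),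
    levi_civita h D -> levi_civita ht Dt ->
    levi_civita (pencil h ht lambda) Dl ->
  forall X a, smooth_vf X -> smooth_form1 a ->
    sharp (pencil h ht lambda) (nabla1 Dl X a)
    =1 sharp h (nabla1 D X a) + lambda *: sharp ht (nabla1 Dt X a).

Definition compatible (h ht : biform) : Prop :=
  almost_compatible h ht /\
  forall (lambda : R) (D Dt Dl : connection),
    levi_civita h D -> levi_civita ht Dt ->
    levi_civita (pencil h ht lambda) Dl ->
  forall X Y a, smooth_vf X -> smooth_vf Y -> smooth_form1 a ->
    sharp (pencil h ht lambda) (curvature1 Dl X Y a)
    =1 sharp h (curvature1 D X Y a) + lambda *: sharp ht (curvature1 Dt X Y a).

Definition mulv (mul : multiplication) (X Y : vfield) : vfield :=
  fun x => mul x (X x) (Y x).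

Record is_multiplication (mul : multiplication) : Prop := IsMultiplication {
  mul_linearl : forall x v, linear (mul x ^~ v);
  mul_linearr : forall x u, linear (mul x u);
  mul_smooth : forall X Y, smooth_vf X -> smooth_vf Y -> smooth_vf (mulv mul X Y)
}.

Definition nabla_mul (D : connection) (mul : multiplication)
    (X Y Z : vfield) : vfield :=
  nabla D X (mulv mul Y Z) - mulv mul (nabla D X Y) Z
  - mulv mul Y (nabla D X Z).

Definition nabla_mul4 (gt : biform) (D : connection) (mul : multiplication)
    (X Y Z V : vfield) : M -> R :=
  eval_form gt (nabla_mul D mul X Y Z) V.

(* wF_T: the operator u |-> (d + k)/2 u - gt(nabla_{gt^* u} E) on 1-forms is
   given by a field A of endomorphisms of the cotangent spaces, all of which
   are invertible. *)
Record weak_F_axioms (mul : multiplication) (E : vfield) (gt : biform)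
    (k d : R) (e Einv : vfield) (D : connection) : Prop := WeakFAxioms {
  wF_mul : is_multiplication mul;
  wF_E : smooth_vf E;
  wF_gt : metric gt;
  wF_D : levi_civita gt D;
  wF_mulA : forall x, associative (mul x);
  wF_mulC : forall x, commutative (mul x);
  wF_e : smooth_vf e;
  wF_mul1 : forall x, left_id (e x) (mul x);
  wF_Einv : smooth_vf Einv;
  wF_mulV : mulv mul Einv E =1 e;
  wF_lie_mul : forall X Y, smooth_vf X -> smooth_vf Y ->
    bracket E (mulv mul X Y) - mulv mul (bracket E X) Y
    - mulv mul X (bracket E Y) =1 k *: mulv mul X Y;
  wF_lie_gt : forall X Y, smooth_vf X -> smooth_vf Y -> forall x,
    vf_deriv E (eval_form gt X Y) x - eval_form gt (bracket E X) Y x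
    - eval_form gt X (bracket E Y) x = d * eval_form gt X Y x;
  wF_T : exists A : M -> 'M[R]_n,
    (forall u, smooth_form1 u -> forall x,
       A x *m u x
       = ((d + k) / 2) *: u x - lower gt (nabla D (sharp gt u) E) x) /\
    (forall x, A x \in unitmx);
  wF_invariant : forall X Y Z, smooth_vf X -> smooth_vf Y -> smooth_vf Z ->
    eval_form gt (mulv mul X Y) Z =1 eval_form gt X (mulv mul Y Z);
  wF_nabla_mul : forall X Y Z, smooth_vf X -> smooth_vf Y -> smooth_vf Z ->
    nabla_mul4 gt D mul X Y Z E =1 nabla_mul4 gt D mul E X Y Z
}.

Definition weak_F_manifold (mul : multiplication) (E : vfield) (gt : biform)
    (k d : R) : Prop :=
  exists e Einv D, weak_F_axioms mul E gt k d e Einv D.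

End TensorFields.

Section Submanifolds.
Context {R : realType} {n m : nat} (N : manifold R n) (M : manifold R m).

Definition smooth_map (i : N -> M) : Prop :=
  continuous i /\
  forall c c', atlas c -> atlas c' ->
    smooth_on (chart_img c `&` (i \o chart_inv c) @^-1` chart_dom c')
      (chart_fun c' \o i \o chart_inv c).

(* The differential of i at x is v |-> v *m tangent_map i x. *)
Definition tangent_map (i : N -> M) (x : N) : 'M[R]_(n, m) :=
  jacobian (chart_fun (chart_at (i x)) \o i \o chart_inv (chart_at x))
    (local_coord x).

(* N is identified with its image under an injective immersion; embedded
   submanifolds are the case where i is moreover a topological embedding. *)
Definition submanifold (i : N -> M) : Prop :=
  [/\ smooth_map i, injective i & forall x, row_free (tangent_map i x)].

(* w in T_{i x} M is tangent to the submanifold. *)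
Definition tangent_to (i : N -> M) (x : N) (w : 'rV[R]_m) : Prop :=
  exists v : 'rV[R]_n, w = v *m tangent_map i x.

Definition induced_metric (i : N -> M) (g : biform M) : biform N :=
  fun x => tangent_map i x *m g (i x) *m (tangent_map i x)^T.

End Submanifolds.

(* Main.v *)
Require Import Defs.
From HB Require Import structures.
From mathcomp Require Import all_boot all_order all_algebra.
From mathcomp Require Import all_classical all_reals all_analysis.
From mathcomp Require Import ring lra.
Import Order.TTheory GRing.Theory Num.Theory.
Import numFieldNormedType.Exports.

(** Write ht and h for the metrics induced by gt and g on N, and A for the
    endomorphism ht h^-1 of TN. Since h and ht come from g^* gt = E . and since
    multiplication by E preserves TN, A is the restriction of this
    multiplication, and the metric h_lambda of the pencil is obtained from ht
    by the endomorphism P = A + lambda: h_lambda(X, Y) = ht(P^-1 X, Y). So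
    everything is about metrics obtained from ht by such a P.

    Let X . Y be the product on TN, F the tangential part of the derivative of
    E, and Dt, D' the Levi-Civita connections of ht and of the deformed metric.
    The axioms on E give, for fields on M,
      nabla_X(E . Y) - E . nabla_X Y = k X . Y + nabla_(X . Y) E - X . nabla_Y E
    ([nabla_mulE]), and F + F^* = d since E is conformal Killing. By the Gauss
    formula ([gauss]) the identity restricts to N:
      (Dt_X P) Y = k X . Y + F (X . Y) - X . F Y
    ([mulE_sub_structure]); normal components drop out because gt is invariant
    under multiplication.

    From this equation and the adjoint of F the connection D' can be computed
    ([deformed_nabla]):
      D'_X (P Y) = P Dt_X Y + X . T Y,   with T = (d + k) / 2 - F.
    Indeed the right-hand side is metric and torsion-free. The last term does
    not depend on P, and for Y the ht-dual of a 1-form a the field P Y is the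
    h_lambda-dual of a. Hence the left-hand side is affine in lambda: this is
    almost compatibility.

    The same two formulas give D'_X U = Dt_X U + (T - k) (X . P^-1 U)
    ([deformed_nabla_inv]). In the second derivative of P Z the operator P^-1
    thus enters through X . P^-1 (Y . T Z) only, which is symmetric in X and Y
    by associativity and cancels in the curvature
    ([deformed_curvature]). So the curvature of P Z is P applied to that of Z
    plus a term free of P, which is compatibility.

    All these identities are between global operators, and evaluating them at
    a point requires global fields with prescribed values there. The analytic
    part constructs them with bump functions, and supplies the calculus of C^k
    maps and the symmetry of second derivatives on which the Gauss formula
    rests. *)

Set Implicit Arguments.
Unset Strict Implicit.
Unset Printing Implicit Defensive.

Local Open Scope classical_set_scope.
Local Open Scope ring_scope.

(** * Calculus of C^k maps on open sets *)

Section Calculus.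
Context {R : realType}.
Implicit Types (V W : normedModType R).

(** 'd is picked by a global choice operator applied to the whole function, so
    that it depends on the germ only has to go through the uniqueness of the
    differential. *)
Lemma near_eq_diff V W (f g : V -> W) x :
  (\near x, f x = g x) -> differentiable f x ->
  differentiable g x /\ 'd g x = 'd f x :> (V -> W).
Proof.
move=> fg df.
have dc : continuous ('d f x) by exact: diff_continuous.
have gx : g x = f x by rewrite (nbhs_singleton fg).
have dg : g \o shift x = cst (g x) + 'd f x +o_ 0 id.
  apply/eqaddoP => _/posnumP[e].
  have /eqaddoP/(_ e%:num (gt0 e)) := diff_locally df.
  have fg0 : \forall h \near (0 : V), f (h + x) = g (h + x).
    have := fg; rewrite (near_shift 0)/=.
    by apply: filterS => h /=; rewrite subr0.
  apply: filterS2 fg0 => h hfg.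
  by rewrite -gx /= !fctE /= hfg.
have dge := diff_unique dc dg.
by split; [apply/diff_locallyP; rewrite dge; split; [exact: dc|exact: dg]|exact: dge].
Qed.

Lemma Ck_subset V W k (U U' : set V) (f : V -> W) :
  U' `<=` U -> Ck_on k U f -> Ck_on k U' f.
Proof.
move=> UU'; elim: k f => [|k IH] f /=; first by move=> h x /UU'/h.
by move=> [d h]; split => [x /UU'/d//|v]; exact: IH.
Qed.

Lemma Ck_pred V W k (U : set V) (f : V -> W) : Ck_on k.+1 U f -> Ck_on k U f.
Proof.
elim: k f => [|k IH] f; first by move=> [d _] x /d/differentiable_continuous.
by move=> [d h]; split => // v; apply: IH; exact: h.
Qed.

Lemma eq_Ck V W k (U : set V) (f g : V -> W) :
  open U -> (forall x, U x -> f x = g x) -> Ck_on k U f -> Ck_on k U g.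
Proof.
move=> oU; elim: k f g => [|k IH] f g fg /=.
  move=> cf x Ux; have nfg : \near x, f x = g x.
    by near=> y; apply: fg; near: y; exact: open_nbhs_nbhs.
  have := cf _ Ux; rewrite /prop_for /continuous_at (fg _ Ux).
  by apply: cvg_trans; exact: near_eq_cvg.
move=> [df h]; have nfg x : U x -> \near x, f x = g x.
  by move=> Ux; near=> y; apply: fg; near: y; exact: open_nbhs_nbhs.
split=> [x Ux|v]; first by have [] := near_eq_diff (nfg _ Ux) (df _ Ux).
apply: IH (h v) => x Ux.
have [_ e] := near_eq_diff (nfg _ Ux) (df _ Ux).
exact: (congr1 (fun h => h v) (esym e)).
Unshelve. all: by end_near. Qed.

(** Ck_on is a conjunction over the points of the set of conditions in which
    the set itself no longer occurs, so nothing has to be glued. *)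
Lemma Ck_local V W k (U : set V) (f : V -> W) :
  (forall x, U x -> exists2 U', U' x & Ck_on k U' f) -> Ck_on k U f.
Proof.
elim: k f => [|k IH] f /=.
  by move=> h x /h[U' U'x]; exact.
move=> h; split=> [x /h[U' U'x [d _]]|v]; first exact: d.
by apply: IH => x /h[U' U'x [_ d]]; exists U'.
Qed.

Lemma Ck_cst V W k (U : set V) (a : W) : Ck_on k U (fun=> a).
Proof.
elim: k a => [|k IH] a /=; first by move=> x _; exact: cst_continuous.
split=> [x _|v]; first exact: (@differentiable_cst _ _ _ a x).
have -> : (fun x => 'd (fun _ : V => a) x v) = fun=> 0.
  by apply/funext => x; rewrite diff_cst.
exact: IH.
Qed.

Lemma Ck_add V W k (U : set V) (f g : V -> W) :
  open U -> Ck_on k U f -> Ck_on k U g -> Ck_on k U (fun x => f x + g x).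
Proof.
move=> oU; elim: k f g => [|k IH] f g /=.
  by move=> cf cg x Ux; apply: continuousD; [exact: cf|exact: cg].
move=> [df hf] [dg hg]; split=> [x Ux|v].
  exact: (differentiableD (df _ Ux) (dg _ Ux)).
apply: (eq_Ck oU _ (IH _ _ (hf v) (hg v))) => x Ux.
exact/esym/(congr1 (fun h => h v) (diffD (df _ Ux) (dg _ Ux))).
Qed.

Lemma Ck_mul V k (U : set V) (f g : V -> R^o) :
  open U -> Ck_on k U f -> Ck_on k U g -> Ck_on k U (fun x => f x * g x : R^o).
Proof.
move=> oU; elim: k f g => [|k IH] f g.
  by move=> cf cg x Ux; apply: (@continuousM R V f g); [exact: cf|exact: cg].
move=> cf cg; have [df hf] := cf; have [dg hg] := cg; split=> [x Ux|v].
  exact: (differentiableM (df _ Ux) (dg _ Ux)).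
have := Ck_add oU (IH _ _ (Ck_pred cf) (hg v)) (IH _ _ (Ck_pred cg) (hf v)).
apply: (eq_Ck oU) => x Ux.
exact/esym/(congr1 (fun h => h v) (diffM (df _ Ux) (dg _ Ux))).
Qed.

(** The derivative - f ^- 2 * f' involves f^-1 itself, but only with one order
    of differentiability less; this is what makes the induction work. *)
Lemma Ck_inv V k (U : set V) (f : V -> R^o) :
  open U -> (forall x, U x -> f x != 0) -> Ck_on k U f ->
  Ck_on k U (fun x => (f x)^-1 : R^o).
Proof.
move=> oU f0; elim: k => [|k IH].
  by move=> cf x Ux; apply: (@continuousV _ _ f); [exact: f0|exact: cf].
move=> cf; have [df hf] := cf; have cV := IH (Ck_pred cf).
split=> [x Ux|v]; first exact: (differentiableV (df _ Ux) (f0 _ Ux)).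
have := Ck_mul oU (Ck_cst k U (-1 : R^o)) (Ck_mul oU (Ck_mul oU cV cV) (hf v)).
apply: (eq_Ck oU) => x Ux.
have e := congr1 (fun h => h v) (diffV (df _ Ux) (f0 _ Ux)).
have alg (a b : R) : -1 * (a^-1 * a^-1 * b) = - a ^- 2 * b.
  by rewrite mulN1r -mulNr -invfM.
exact: etrans (alg _ _) (esym e).
Qed.

Lemma Ck_sum V W k (U : set V) (I : Type) (r : seq I) (P : pred I)
    (f : I -> V -> W) :
  open U -> (forall i, Ck_on k U (f i)) ->
  Ck_on k U (fun x => \sum_(i <- r | P i) f i x).
Proof.
move=> oU h; elim: r => [|i r IH].
  by apply: (eq_Ck oU _ (Ck_cst k U 0)) => x _; rewrite big_nil.
case Pi : (P i).
  by apply: (eq_Ck oU _ (Ck_add oU (h i) IH)) => x _; rewrite big_cons Pi.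
by apply: (eq_Ck oU _ IH) => x _; rewrite big_cons Pi.
Qed.

Lemma Ck_prod V k (U : set V) (I : Type) (r : seq I) (P : pred I)
    (f : I -> V -> R^o) :
  open U -> (forall i, Ck_on k U (f i)) ->
  Ck_on k U (fun x => \prod_(i <- r | P i) f i x : R^o).
Proof.
move=> oU h; elim: r => [|i r IH].
  by apply: (eq_Ck oU _ (Ck_cst k U (1 : R^o))) => x _; rewrite big_nil.
case Pi : (P i).
  by apply: (eq_Ck oU _ (Ck_mul oU (h i) IH)) => x _; rewrite big_cons Pi.
by apply: (eq_Ck oU _ IH) => x _; rewrite big_cons Pi.
Qed.

Lemma diff_entry V m n (F : V -> 'M[R]_(m, n)) x v i j :
  differentiable F x ->
  differentiable (fun y => F y i j : R^o) x /\
  'd (fun y => F y i j : R^o) x v = 'd F x v i j.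
Proof.
move=> dF.
have dc : differentiable (fun N : 'M[R]_(m, n) => N i j : R^o) (F x).
  exact: differentiable_coord.
split; first exact: (differentiable_comp dF dc).
have @c : {linear 'M[R]_(m, n) -> R^o}.
  by exists (fun N : 'M[R]_(_, _) => N i j); do 2![eexists]; do ?[constructor];
     rewrite ?mxE// => ? *; rewrite ?mxE//; move=> ?; rewrite !mxE.
have cc : continuous c by exact: coord_continuous.
have -> : (fun y => F y i j : R^o) = c \o F by [].
have dc' : differentiable c (F x) by exact: linear_differentiable.
by rewrite (diff_comp dF dc') /= (diff_lin _ cc).
Qed.

Lemma differentiable_entries V m n (F : V -> 'M[R]_(m, n)) x :
  (forall i j, differentiable (fun y => F y i j : R^o) x) -> differentiable F x.
Proof.
move=> h.
have -> : F = \sum_(i < m) \sum_(j < n) (fun y => (F y i j : R^o) *: delta_mx i j).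
  apply/funext => y; rewrite fct_sumE [LHS]matrix_sum_delta.
  by apply: eq_bigr => i _; rewrite fct_sumE.
apply: differentiable_sum => i; apply: differentiable_sum => j.
exact: (@differentiableZl _ _ _ (fun y => F y i j) (delta_mx i j)).
Qed.

(** Reduces the calculus of matrix-valued maps to the product and quotient
    rules for scalar ones. *)
Lemma Ck_entries V m n k (U : set V) (F : V -> 'M[R]_(m, n)) :
  open U ->
  Ck_on k U F <-> forall i j, Ck_on k U (fun x => F x i j : R^o).
Proof.
move=> oU; elim: k F => [|k IH] F.
  split=> [cF i j x Ux|cF x Ux].
    exact: (continuous_comp (cF _ Ux) (@coord_continuous _ _ _ i j (F x))).
  apply/cvg_ballP => e e0; 
  have h : \forall y \near x, forall i j, ball (F x i j) e (F y i j).
    apply: filter_forall => i; apply: filter_forall => j.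
    by have /cvg_ballP := cF i j x Ux; apply.
  by apply: filterS h => y h; split.
split=> [[d h] i j|h].
  split=> [x Ux|v]; first by have [] := diff_entry 0 i j (d _ Ux).
  have /IH/(_ i j) := h v.
  by apply: (eq_Ck oU) => x Ux; have [_ ->] := diff_entry v i j (d _ Ux).
have d x : U x -> differentiable F x.
  by move=> Ux; apply: differentiable_entries => i j; case: (h i j) => [+ _]; apply.
split => // v; apply/IH => i j; case: (h i j) => [_ /(_ v)].
by apply: (eq_Ck oU) => x Ux; have [_ ->] := diff_entry v i j (d _ Ux).
Unshelve. all: by end_near. Qed.

Lemma Ck_id V k (U : set V) : Ck_on k U (@id V).
Proof.
case: k => [|k] /=; first by move=> x _; move=> A; exact.
split => [x _|v]; first exact: ex_diff.
have -> : (fun x : V => 'd (@id V) x v) = fun=> v by apply/funext => x; rewrite diff_val.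
exact: Ck_cst.
Qed.

Lemma derive_row n (g : 'rV[R]_n -> R^o) y (u : 'rV[R]_n) :
  'd g y u = \sum_j u 0 j * 'd g y (delta_mx 0 j).
Proof.
by rewrite {1}(row_sum_delta u) linear_sum; apply: eq_bigr => j _; rewrite linearZ.
Qed.

(** In the derivative 'd g (f x) ('d f x v) the direction of differentiation
    moves with x, whereas Ck_on only speaks of fixed directions; expanding
    'd f x v in the standard basis repairs this. *)
Lemma Ck_comp_scalar V n k (U : set V) (U' : set 'rV[R]_n)
    (f : V -> 'rV[R]_n) (g : 'rV[R]_n -> R^o) :
  open U -> open U' -> (forall x, U x -> U' (f x)) ->
  Ck_on k U f -> Ck_on k U' g -> Ck_on k U (fun x => g (f x)).
Proof.
move=> oU oU' fU; elim: k g => [|k IH] g.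
  by move=> cf cg x Ux; exact: (continuous_comp (cf _ Ux) (cg _ (fU _ Ux))).
move=> cf [dg hg]; have [df hf] := cf; split => [x Ux|v].
  exact: (differentiable_comp (df _ Ux) (dg _ (fU _ Ux))).
have h j : Ck_on k U (fun x => ('d f x v) 0 j * 'd g (f x) (delta_mx 0 j) : R^o).
  apply: Ck_mul => //; first by have /(Ck_entries k _ oU) := hf v; apply.
  by apply: (IH (fun y => 'd g y (delta_mx 0 j))); [exact: Ck_pred|exact: hg].
apply: (eq_Ck oU _ (Ck_sum (index_enum 'I_n) xpredT oU h)) => x Ux.
rewrite -derive_row.
have e := diff_comp (df _ Ux) (dg _ (fU _ Ux)).
exact: (congr1 (fun h => h v) (esym e)).
Qed.

Lemma Ck_comp V n m p k (U : set V) (U' : set 'rV[R]_n)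
    (f : V -> 'rV[R]_n) (g : 'rV[R]_n -> 'M[R]_(m, p)) :
  open U -> open U' -> (forall x, U x -> U' (f x)) ->
  Ck_on k U f -> Ck_on k U' g -> Ck_on k U (fun x => g (f x)).
Proof.
move=> oU oU' fU cf /(Ck_entries k _ oU') cg; apply/(Ck_entries k _ oU) => i j.
exact: (@Ck_comp_scalar _ _ _ _ U' _ (fun y => g y i j)).
Qed.

Lemma Ck_mulmx V m n p k (U : set V) (F : V -> 'M[R]_(m, n)) (G : V -> 'M[R]_(n, p)) :
  open U -> Ck_on k U F -> Ck_on k U G -> Ck_on k U (fun x => F x *m G x).
Proof.
move=> oU /(Ck_entries k _ oU) cF /(Ck_entries k _ oU) cG.
apply/(Ck_entries k _ oU) => i j.
apply: (eq_Ck oU _ (Ck_sum (index_enum 'I_n) xpredT oU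
  (fun l => Ck_mul oU (cF i l) (cG l j)))) => x _.
by rewrite mxE.
Qed.

Lemma Ck_tr V m n k (U : set V) (F : V -> 'M[R]_(m, n)) :
  open U -> Ck_on k U F -> Ck_on k U (fun x => (F x)^T).
Proof.
move=> oU /(Ck_entries k _ oU) cF; apply/(Ck_entries k _ oU) => i j.
by apply: (eq_Ck oU _ (cF j i)) => x _; rewrite mxE.
Qed.

Lemma Ck_scale V m n k (U : set V) (f : V -> R^o) (F : V -> 'M[R]_(m, n)) :
  open U -> Ck_on k U f -> Ck_on k U F -> Ck_on k U (fun x => f x *: F x).
Proof.
move=> oU cf /(Ck_entries k _ oU) cF; apply/(Ck_entries k _ oU) => i j.
by apply: (eq_Ck oU _ (Ck_mul oU cf (cF i j))) => x _; rewrite mxE.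
Qed.

Lemma Ck_det V n k (U : set V) (F : V -> 'M[R]_n) :
  open U -> Ck_on k U F -> Ck_on k U (fun x => \det (F x) : R^o).
Proof.
move=> oU /(Ck_entries k _ oU) cF; rewrite /determinant.
apply: Ck_sum => // s; apply: Ck_mul => //; first exact: (Ck_cst k U (_ : R^o)).
exact: Ck_prod.
Qed.

(** By Cramer's rule. *)
Lemma Ck_invmx V n k (U : set V) (F : V -> 'M[R]_n) :
  open U -> (forall x, U x -> F x \in unitmx) -> Ck_on k U F ->
  Ck_on k U (fun x => invmx (F x)).
Proof.
move=> oU uF cF.
have cV : Ck_on k U (fun x => (\det (F x))^-1 : R^o).
  by apply: Ck_inv; [|move=> x /uF; rewrite unitmxE unitfE|exact: Ck_det].
have cA : Ck_on k U (fun x => \adj (F x)).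
  apply/(Ck_entries k _ oU) => i j.
  have cM : Ck_on k U (fun x => row' j (col' i (F x))).
    apply/(Ck_entries k _ oU) => a b.
    have /(Ck_entries k _ oU)/(_ (lift j a) (lift i b)) := cF.
    by apply: (eq_Ck oU) => x _; rewrite !mxE.
  apply: (eq_Ck oU _ (Ck_mul oU (Ck_cst k U ((-1) ^+ (j + i) : R^o)) (Ck_det oU cM))).
  by move=> x _; rewrite mxE.
apply: (eq_Ck oU _ (Ck_scale oU cV cA)) => x /uF ux.
by rewrite /invmx ux.
Qed.

Lemma derive_entry V m n (F : V -> 'M[R]_(m, n)) x v i j :
  derivable F x v -> ('D_v F x) i j = 'D_v (fun y => F y i j : R^o) x.
Proof. by move=> dF; rewrite derive_mx// mxE. Qed.

Lemma derivable_entry V m n (F : V -> 'M[R]_(m, n)) x v i j :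
  derivable F x v -> derivable (fun y => F y i j : R^o) x v.
Proof. by move=> /derivable_mxP. Qed.

Lemma derivable_mulmx V m n p (F : V -> 'M[R]_(m, n)) (G : V -> 'M[R]_(n, p)) x v :
  derivable F x v -> derivable G x v ->
  derivable (fun y => F y *m G y) x v /\
  'D_v (fun y => F y *m G y) x = 'D_v F x *m G x + F x *m 'D_v G x.
Proof.
move=> dF dG.
have dij i j l : derivable (fun y => F y i l * G y l j : R^o) x v.
  by apply: (@derivableM _ _ (fun y => F y i l) (fun y => G y l j)); exact: derivable_entry.
have e i j : (fun y => (F y *m G y) i j : R^o) =
    \sum_(l < n) (fun y => F y i l * G y l j : R^o).
  by apply/funext => y; rewrite mxE fct_sumE.
have d : derivable (fun y => F y *m G y) x v.
  by apply/derivable_mxP => i j; rewrite e; apply: derivable_sum.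
split => //; apply/matrixP => i j; rewrite derive_entry // e derive_sum //.
rewrite !mxE -big_split; apply: eq_bigr => l _ /=.
rewrite (@deriveM _ _ (fun y => F y i l) (fun y => G y l j)); try exact: derivable_entry.
by rewrite !derive_entry// addrC /=; congr (_ + _); rewrite mulrC.
Qed.

Lemma derivable_tr V m n (F : V -> 'M[R]_(m, n)) x v :
  derivable F x v -> derivable (fun y => (F y)^T) x v /\
  'D_v (fun y => (F y)^T) x = ('D_v F x)^T.
Proof.
move=> dF; have e i j : (fun y => (F y)^T i j : R^o) = fun y => F y j i.
  by apply/funext => y; rewrite mxE.
have d : derivable (fun y => (F y)^T) x v.
  by apply/derivable_mxP => i j; rewrite e; exact: derivable_entry.
by split => //; apply/matrixP => i j; rewrite mxE !derive_entry// e.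
Qed.

Lemma Ck_derivable V W k (U : set V) (f : V -> W) x v :
  Ck_on k.+1 U f -> U x -> derivable f x v.
Proof. by move=> [d _] /d; exact: diff_derivable. Qed.

Lemma Ck_derive V W k (U : set V) (f : V -> W) v :
  open U -> Ck_on k.+1 U f -> Ck_on k U (fun x => 'D_v f x).
Proof.
by move=> oU [d h]; apply: (eq_Ck oU _ (h v)) => x Ux; rewrite deriveE//; exact: d.
Qed.

Lemma Ck_jacobian n m k (U : set 'rV[R]_n) (f : 'rV[R]_n -> 'rV[R]_m) :
  open U -> Ck_on k.+1 U f -> Ck_on k U (fun x => jacobian f x).
Proof.
move=> oU [d h]; apply/(Ck_entries k _ oU) => i j.
have /(Ck_entries k _ oU)/(_ 0 j) := h (delta_mx 0 i).
by apply: (eq_Ck oU) => x _; rewrite !mxE.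
Qed.

End Calculus.

(** * Symmetry of second derivatives *)

Section Schwarz.
Context {R : realType}.
Implicit Types (V W : normedModType R).

Lemma derive_line V (f : V -> R^o) (x u : V) (s : R) :
  differentiable f (x + s *: u) ->
  is_derive s (1 : R^o) (fun s : R^o => f (x + s *: u)) ('d f (x + s *: u) u).
Proof.
move=> df.
have dl : is_diff s (fun s : R^o => x + s *: u) (fun s => s *: u).
  have h := is_diffD (is_diff_cst x s) (is_diff_scalel s u).
  apply: DiffDef; first exact: ex_diff.
  by have := @diff_val _ _ _ _ _ _ _ h => ->; rewrite add0r.
have d : differentiable (f \o (fun s : R^o => x + s *: u)) s.
  exact: differentiable_comp.
apply: DeriveDef; first exact: diff_derivable.
by rewrite deriveE // diff_comp //= diff_val scale1r.
Qed.

(** The mean value theorem, applied first along u and then along v, turns the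
    second difference into h * h times a mixed second derivative at a point
    close to x. *)
Lemma second_difference V (U : set V) (f : V -> R^o) (x u v : V) (e : R) :
  open U -> Ck_on 2 U f -> U x -> 0 < e ->
  exists2 r : R, 0 < r & forall h, 0 < h -> h < r ->
    `|(f (x + h *: u + h *: v) - f (x + h *: u) - f (x + h *: v) + f x)
      - h * h * 'd (fun y => 'd f y u) x v| <= h * h * e.
Proof.
move=> oU [df cf] Ux e0.
have [df' cf'] := cf u.
set g := fun y => 'd f y u.
have cg : {for x, continuous (fun y => 'd g y v)} by exact: (cf' v x Ux).
have : \forall y \near x, U y /\ `|'d g x v - 'd g y v| <= e.
  near=> y; split; first by near: y; exact: open_nbhs_nbhs.
  by near: y; have /cvgrPdist_le := cg; apply.
case/nbhs_ballP => r0 /= r00 hr.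
have kpos : 0 < `|u| + `|v| + 1 by rewrite ltr_wpDl// addr_ge0.
exists (r0 / (`|u| + `|v| + 1)); first by rewrite divr_gt0.
move=> h h0; rewrite ltr_pdivlMr // => hr0.
have near_x s t : 0 <= s -> s <= h -> 0 <= t -> t <= h ->
    U (x + t *: v + s *: u) /\ `|'d g x v - 'd g (x + t *: v + s *: u) v| <= e.
  move=> s0 sh t0 th; apply: hr; rewrite -ball_normE /= -addrA opprD addNKr normrN.
  apply: le_lt_trans (ler_normD _ _) _; rewrite !normrZ !ger0_norm//.
  apply: le_lt_trans hr0; rewrite !mulrDr mulr1.
  have := ler_wpM2r (normr_ge0 u) sh; have := ler_wpM2r (normr_ge0 v) th.
  lra.
pose phi s : R^o := f (x + h *: v + s *: u) - f (x + s *: u).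
have dphi s : s \in `]0, h[%R ->
    is_derive s (1 : R^o) phi (g (x + h *: v + s *: u) - g (x + s *: u)).
  rewrite in_itv /= => /andP[/ltW s0 /ltW sh].
  have d1 : differentiable f (x + h *: v + s *: u).
    by apply: df; have [] := near_x s h s0 sh (ltW h0) (lexx _).
  have d2 : differentiable f (x + s *: u).
    by apply: df; have [] := near_x s 0 s0 sh (lexx _) (ltW h0); rewrite scale0r addr0.
  by apply: is_deriveB; exact: derive_line.
have cphi : {within `[0, h], continuous phi}.
  apply: derivable_within_continuous => s; rewrite in_itv /= => /andP[s0 sh].
  have d1 : differentiable f (x + h *: v + s *: u).
    by apply: df; have [] := near_x s h s0 sh (ltW h0) (lexx _).
  have d2 : differentiable f (x + s *: u).
    by apply: df; have [] := near_x s 0 s0 sh (lexx _) (ltW h0); rewrite scale0r addr0.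
  by apply: derivableB; exact: (@ex_derive _ _ _ _ _ _ _ (derive_line _)).
have [c cI ephi] := MVT h0 dphi cphi.
move: cI; rewrite in_itv /= => /andP[/ltW c0 /ltW ch].
pose psi t : R^o := g (x + c *: u + t *: v).
have sw t : x + c *: u + t *: v = x + t *: v + c *: u by rewrite addrAC.
have dpsi t : t \in `]0, h[%R ->
    is_derive t (1 : R^o) psi ('d g (x + c *: u + t *: v) v).
  rewrite in_itv /= => /andP[/ltW t0 /ltW th]; apply: derive_line.
  by apply: df'; rewrite sw; have [] := near_x c t c0 ch t0 th.
have cpsi : {within `[0, h], continuous psi}.
  apply: derivable_within_continuous => t; rewrite in_itv /= => /andP[t0 th].
  apply: (@ex_derive _ _ _ _ _ _ _ (derive_line _)).
  by apply: df'; rewrite sw; have [] := near_x c t c0 ch t0 th.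
have [d dI epsi] := MVT h0 dpsi cpsi.
move: dI; rewrite in_itv /= => /andP[/ltW d0 /ltW dh].
have [_ hd] := near_x c d c0 ch d0 dh.
have -> : f (x + h *: u + h *: v) - f (x + h *: u) - f (x + h *: v) + f x =
    h * h * 'd g (x + d *: v + c *: u) v.
  have : phi h - phi 0 = h * h * 'd g (x + d *: v + c *: u) v.
    rewrite ephi -!sw subr0 -mulrA mulrC; congr (_ * _).
    by move: epsi; rewrite /psi scale0r addr0 sw subr0 sw mulrC => ->.
  move=> <-; rewrite /phi !scale0r !addr0 (addrAC x).
  ring.
have hh : 0 < h * h by rewrite mulr_gt0.
by rewrite -mulrBr normrM (ger0_norm (ltW hh)) distrC ler_pM2l.
Unshelve. all: by end_near. Qed.

(** The second difference is symmetric in u and v, while its quotient by h * h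
    tends to the mixed derivative in either order. *)
Lemma schwarz V (U : set V) (f : V -> R^o) (x u v : V) :
  open U -> Ck_on 2 U f -> U x ->
  'd (fun y => 'd f y u) x v = 'd (fun y => 'd f y v) x u.
Proof.
move=> oU cf Ux; apply/eqP; rewrite -subr_eq0 -normr_eq0 eq_le normr_ge0 andbT.
apply/ler_addgt0Pl => e e0; rewrite addr0; rewrite [e]splitr.
have e20 : 0 < e / 2 by rewrite divr_gt0.
have [r1 r10 h1] := second_difference u v oU cf Ux e20.
have [r2 r20 h2] := second_difference v u oU cf Ux e20.
pose h := Num.min r1 r2 / 2.
have m0 : 0 < Num.min r1 r2 by rewrite lt_min r10 r20.
have h0 : 0 < h by rewrite /h divr_gt0.
have hm : h < Num.min r1 r2 by rewrite /h; lra.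
move: hm; rewrite lt_min => /andP[hr1 hr2].
have {}h1 := h1 h h0 hr1; have {}h2 := h2 h h0 hr2.
have hh : 0 < h * h by rewrite mulr_gt0.
rewrite -(ler_pM2l hh) -{1}(ger0_norm (ltW hh)) -normrM.
set A := 'd _ x v in h1 *; set B := 'd _ x u in h2 *.
have e1 : x + h *: v + h *: u = x + h *: u + h *: v by rewrite addrAC.
rewrite e1 in h2.
set a := f (x + h *: u + h *: v) in h1 h2; set b := f (x + h *: u) in h1 h2.
set c := f (x + h *: v) in h1 h2.
have -> : h * h * (A - B) = (a - c - b + f x - h * h * B) - (a - b - c + f x - h * h * A).
  by ring.
apply: le_trans (ler_normB _ _) _.
by rewrite mulrDr lerD.
Qed.

Lemma schwarz_derive V m n (U : set V) (F : V -> 'M[R]_(m, n)) (x u v : V) :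
  open U -> Ck_on 2 U F -> U x ->
  'D_u ('D_v F) x = 'D_v ('D_u F) x.
Proof.
move=> oU cF Ux.
have cF' := Ck_derive _ oU cF.
apply/matrixP => i j.
have key w z : ('D_w ('D_z F) x) i j = 'd (fun y => 'd (fun y => F y i j : R^o) y z) x w.
  rewrite derive_entry; last exact: Ck_derivable (cF' z) Ux.
  have /(Ck_entries _ _ oU)/(_ i j) cFij := cF.
  have [_ /(_ z) cd] := cFij.
  have e : (fun y => 'D_z F y i j : R^o) x = 'd (fun y => F y i j : R^o) x z.
    rewrite derive_entry; last exact: Ck_derivable cF Ux.
    by rewrite deriveE //; case: cFij => + _; apply.
  rewrite -[RHS]deriveE; last by case: cd => + _; apply.
  apply: near_eq_derive; near=> y.
  have Uy : U y by near: y; exact: open_nbhs_nbhs.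
  rewrite derive_entry; last exact: Ck_derivable cF Uy.
  by rewrite deriveE //; case: cFij => + _; apply.
have /(Ck_entries _ _ oU)/(_ i j) cFij := cF.
have sch := schwarz v u oU cFij Ux.
have k1 := key u v.
have k2 := key v u.
have k3 := etrans k1 sch.
exact: (etrans k3 (esym k2)).
Unshelve. all: by end_near. Qed.

End Schwarz.

(** * Bump functions *)

Section Bump.
Context {R : realType}.
Implicit Types (V W : normedModType R).

(** t |-> t ^- n * exp (- 1 / t), extended by 0: the family is closed under
    differentiation up to linear combinations, so that all its members are
    smooth at once. *)
Definition flat_exp (n : nat) (t : R) : R :=
  if 0 < t then t^-1 ^+ n * expR (- t^-1) else 0.

(** The exponential series gives exp (1 / t) >= t ^- (n + 2) / (n + 2)!. The
    quadratic bound yields the derivative 0 at the origin. *)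
Lemma flat_exp_bound n (t : R) : `|flat_exp n t| <= (n.+2)`!%:R * t ^+ 2.
Proof.
rewrite /flat_exp; case: ifPn => t0; last by rewrite normr0 mulr_ge0// sqr_ge0.
have tV0 : 0 < t^-1 by rewrite invr_gt0.
rewrite ger0_norm; last by rewrite mulr_ge0 ?expR_ge0// exprn_ge0// ltW.
have ge : t^-1 ^+ n.+2 / (n.+2)`!%:R <= expR t^-1.
  by apply: le_trans (expR_ge1Dxn n.+1 (ltW tV0)); rewrite lerDr.
have f0 : 0 < (n.+2)`!%:R :> R by rewrite ltr0n fact_gt0.
rewrite expRN ler_pdivrMr ?expR_gt0//.
have B0 : 0 <= (n.+2)`!%:R * t ^+ 2 by rewrite mulr_ge0// ?sqr_ge0// ltW.
apply: le_trans (ler_wpM2l B0 ge).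
have -> : (n.+2)`!%:R * t ^+ 2 * (t^-1 ^+ n.+2 / (n.+2)`!%:R) = t^-1 ^+ n.
  rewrite !exprS; field.
  by rewrite !gt_eqF.
by [].
Qed.

Lemma flat_exp_derive n (t : R) :
  is_derive t (1 : R) (flat_exp n) (flat_exp n.+2 t - n%:R * flat_exp n.+1 t).
Proof.
have [t0|t0|->] := ltrgtP t 0.
- have -> : flat_exp n.+2 t - n%:R * flat_exp n.+1 t = 0.
    by rewrite /flat_exp ltNge ltW //= mulr0 subr0.
  have dc : is_derive t (1 : R) (cst 0 : R -> R) 0 by exact: is_derive_cst.
  apply: near_eq_is_derive dc; near=> s; have s0 : s < 0 by near: s; exact: lt_nbhsl.
  by rewrite /flat_exp ltNge (ltW s0).
- have nz : t != 0 by rewrite gt_eqF.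
  pose w s : R := s^-1.
  have dw : is_derive t (1 : R) w (- t ^- 2 * 1).
    exact: (is_deriveV nz (is_derive_id t 1)).
  have dN : is_derive t (1 : R) (- w) (- (- t ^- 2 * 1)) by exact: is_deriveN.
  have dE : is_derive t (1 : R) (expR \o (- w)) (expR (- t^-1) * (- (- t ^- 2 * 1))).
    by apply: is_derive1_comp.
  have dX := is_deriveX n dw.
  have dM := is_deriveM dX dE.
  have -> : flat_exp n.+2 t - n%:R * flat_exp n.+1 t =
     (w ^+ n) t *: (expR (- t^-1) * - (- t ^- 2 * 1)) +
     (expR \o - w) t *: ((n%:R * w t ^+ n.-1) *: (- t ^- 2 * 1)).
    have alg (x y : R) m : x ^+ m.+2 * y - m%:R * (x ^+ m.+1 * y) =
        x ^+ m * (y * - (- x ^+ 2 * 1)) + y * (m%:R * x ^+ m.-1 * (- x ^+ 2 * 1)).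
      by case: m => [|m] /=; rewrite !exprS; ring.
    by rewrite /flat_exp t0 exprfctE -exprVn; exact: alg.
  apply: near_eq_is_derive dM; near=> s.
  have s0 : 0 < s by near: s; exact: lt_nbhsr.
  by rewrite /flat_exp s0 /= -[(w ^+ n * _) s]/((w ^+ n) s * expR (- s^-1)) exprfctE.
- have -> : flat_exp n.+2 0 - n%:R * flat_exp n.+1 0 = 0 by rewrite /flat_exp ltxx mulr0 subr0.
  have cv : (fun h => h^-1 *: ((flat_exp n \o shift 0) (h *: 1) - flat_exp n 0)) @ 0^' --> (0 : R).
    apply/cvgrPdist_le => e e0; near=> h.
    have h0 : h != 0 by near: h; exact: nbhs_dnbhs_neq.
    have f0 : flat_exp n 0 = 0 by rewrite /flat_exp ltxx.
    rewrite sub0r normrN normrZ /= f0 subr0 addr0 [_%:A]mulr1 normfV.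
    rewrite ler_pdivrMl ?normr_gt0//.
    apply: le_trans (flat_exp_bound n h) _.
    rewrite -[h ^+ 2]ger0_norm ?sqr_ge0// normrX expr2 mulrCA.
    rewrite ler_pM2l ?normr_gt0// -ler_pdivlMl ?ltr0n ?fact_gt0//.
    near: h; apply: dnbhs0_le.
    by rewrite mulr_gt0// invr_gt0 ltr0n fact_gt0.
  by apply: DeriveDef; [apply/cvg_ex; exists 0|exact: cvg_lim].
Unshelve. all: by end_near. Qed.

Lemma Ck_flat_exp V k n (U : set V) (q : V -> R^o) :
  open U -> Ck_on k U q -> Ck_on k U (fun x => flat_exp n (q x) : R^o).
Proof.
have df m t : differentiable (flat_exp m : R^o -> R^o) t.
  by apply/derivable1_diffP; case: (flat_exp_derive m t).
move=> oU; elim: k n => [|k IH] n.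
  move=> cq x Ux; apply: (continuous_comp (cq _ Ux)).
  exact: (differentiable_continuous (df n (q x))).
move=> cq; have [dq hq] := cq; split=> [x Ux|v].
  exact: (differentiable_comp (dq _ Ux) (df n _)).
have cq' := Ck_pred cq.
have c2 := IH n.+2 cq'; have c1 := IH n.+1 cq'.
have := Ck_mul oU (Ck_add oU c2 (Ck_mul oU (Ck_cst k U (- n%:R : R^o)) c1)) (hq v).
apply: (eq_Ck oU) => x Ux.
have e := congr1 (fun h => h v) (diff_comp (dq _ Ux) (df n (q x))).
apply: etrans (esym e) => /=.
have [_ dv] := flat_exp_derive n (q x).
have lin w : 'd (flat_exp n : R^o -> R^o) (q x) w = w * 'd (flat_exp n : R^o -> R^o) (q x) 1.
  by rewrite -[X in 'd _ _ X = _]mulr1 [LHS]linearZ.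
have de : 'd (flat_exp n : R^o -> R^o) (q x) 1 = flat_exp n.+2 (q x) - n%:R * flat_exp n.+1 (q x).
  by rewrite -dv; exact/esym/deriveE.
by rewrite lin de mulNr mulrC.
Qed.

Lemma flat_exp0_gt0 (t : R) : (0 < flat_exp 0 t) = (0 < t).
Proof. by rewrite /flat_exp; case: ifPn => // _; rewrite ?ltxx// expr0 mul1r expR_gt0. Qed.

Lemma flat_exp0_ge0 (t : R) : 0 <= flat_exp 0 t.
Proof. by rewrite /flat_exp; case: ifPn => // _; rewrite expr0 mul1r expR_ge0. Qed.

Lemma flat_exp_le0 n (t : R) : t <= 0 -> flat_exp n t = 0.
Proof. by rewrite /flat_exp leNgt => /negPf ->. Qed.

Definition smooth_step (t : R) : R := flat_exp 0 t / (flat_exp 0 t + flat_exp 0 (1 - t)).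

Lemma smooth_step_den (t : R) : 0 < flat_exp 0 t + flat_exp 0 (1 - t).
Proof.
have [t0|t0] := ltP 0 t; first by rewrite ltr_pwDl ?flat_exp0_gt0 ?flat_exp0_ge0.
by rewrite ltr_wpDl ?flat_exp0_ge0// flat_exp0_gt0; lra.
Qed.

Lemma smooth_step_eq0 t : t <= 0 -> smooth_step t = 0.
Proof. by move=> t0; rewrite /smooth_step flat_exp_le0 // mul0r. Qed.

Lemma smooth_step_eq1 t : 1 <= t -> smooth_step t = 1.
Proof.
move=> t1; rewrite /smooth_step (@flat_exp_le0 0 (1 - t)) ?addr0; last lra.
by rewrite divff// gt_eqF// flat_exp0_gt0; lra.
Qed.

(** Compose the smooth step with an affine function of the squared Euclidean
    distance to z0. The plateau W on which b is 1 makes fields with constant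
    components available; the compactness of K is what allows b to be extended
    by 0 to a manifold. *)
Lemma bump_rV n (z0 : 'rV[R]_n) (U : set 'rV[R]_n) : open U -> U z0 ->
  exists (b : 'rV[R]_n -> R^o) (K W : set 'rV[R]_n),
    [/\ smooth_on setT b, compact K /\ K `<=` U, (forall z, ~ K z -> b z = 0),
        open W /\ W z0 & W `<=` U /\ (forall z, W z -> b z = 1)].
Proof.
move=> oU Uz0; have : nbhs z0 U by exact: open_nbhs_nbhs.
case/nbhs_ballP => r /= r0 rU.
pose q (z : 'rV[R]_n) : R^o := \sum_j (z 0 j - z0 0 j) * (z 0 j - z0 0 j).
(* s >= 1 where q <= r ^ 2 / 8, and s <= 0 where q >= r ^ 2 / 4; the latter
   holds outside the ball K of the maximum norm. *)
pose s (z : 'rV[R]_n) : R^o := 2 + (- 8 / r ^+ 2) * q z.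
have r2 : 0 < r ^+ 2 by rewrite exprn_gt0.
have cs k : Ck_on k setT s.
  have oT : open (@setT 'rV[R]_n) by exact: openT.
  apply: Ck_add => //; first exact: (Ck_cst k setT (2 : R^o)).
  apply: Ck_mul => //; first exact: (Ck_cst k setT (- 8 / r ^+ 2 : R^o)).
  have cj j : Ck_on k setT (fun z : 'rV[R]_n => z 0 j - z0 0 j : R^o).
    apply: Ck_add => //; last exact: (Ck_cst k setT (- z0 0 j : R^o)).
    by have /(Ck_entries k _ oT) := @Ck_id _ 'rV[R]_n k setT; apply.
  by apply: Ck_sum => // j; exact: Ck_mul.
pose b z : R^o := smooth_step (s z).
pose K := [set z : 'rV[R]_n | `|z - z0| <= r / 2].
pose W := [set z : 'rV[R]_n | 1 < s z].
have KU : K `<=` U.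
  move=> z zK; apply: rU; rewrite -ball_normE /= distrC.
  by apply: le_lt_trans zK _; rewrite ltr_pdivrMr// ltr_pMr// ltr1n.
have bK z : ~ K z -> b z = 0.
  move=> nK; apply: smooth_step_eq0.
  have [j hj] : exists j, r / 2 < `|z 0 j - z0 0 j|.
    apply/not_existsP => h; apply: nK; rewrite /K /= /Num.norm /= mx_normrE.
    apply: bigmax_le; first by rewrite divr_ge0// ltW.
    by case=> a j _; rewrite ord1 !mxE /=; move/negP: (h j); rewrite -leNgt.
  have hq : (r / 2) ^+ 2 <= q z.
    rewrite /q (bigD1 j)//= -expr2 -[leLHS]addr0 lerD//.
      rewrite -[leRHS]ger0_norm ?sqr_ge0// normrX lerXn2r ?nnegrE//.
        by rewrite divr_ge0// ltW.
      exact: ltW.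
    by apply: sumr_ge0 => i _; rewrite -expr2 sqr_ge0.
  have -> : s z = 2 - 8 * (q z / r ^+ 2) by rewrite /s; field; rewrite gt_eqF.
  have : (r / 2) ^+ 2 / r ^+ 2 <= q z / r ^+ 2 by rewrite ler_pM2r ?invr_gt0.
  have -> : (r / 2) ^+ 2 / r ^+ 2 = 4^-1 by field; rewrite gt_eqF.
  lra.
(* W lies in U because b does not vanish on W. *)
have W1 z : W z -> b z = 1 by move=> Wz; apply: smooth_step_eq1; exact: ltW.
exists b, K, W; split => //.
- move=> k.
  have oT : open (@setT 'rV[R]_n) by exact: openT.
  apply: Ck_mul => //; first exact: Ck_flat_exp.
  apply: Ck_inv => //; first by move=> z _; rewrite gt_eqF// smooth_step_den.
  apply: Ck_add => //; first exact: Ck_flat_exp.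
  apply: Ck_flat_exp => //.
  have := Ck_add oT (Ck_cst k setT (1 : R^o)) (Ck_mul oT (Ck_cst k setT (-1 : R^o)) (cs k)).
  by apply: eq_Ck => // z _; rewrite mulN1r.
- split => //; apply: bounded_closed_compact.
    exists (`|z0| + r / 2); split; first exact: num_real.
    move=> x hx z zK; apply: ltW; apply: le_lt_trans hx.
    by have := ler_normD (z - z0) z0; rewrite subrK => /le_trans; apply; rewrite addrC lerD2l.
  have -> : K = (fun z => `|z - z0|) @^-1` [set x | x <= r / 2] by [].
  apply: closed_comp; last exact: closed_le.
  move=> z _; apply: continuous_comp; last exact: norm_continuous.
  by apply: continuousB => //; exact: cst_continuous.
- split; last by rewrite /W /= /s /q big1 ?mulr0 ?addr0 ?ltr1n// => j _; rewrite subrr mul0r.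
  have -> : W = s @^-1` [set x | 1 < x] by [].
  apply: open_comp; last exact: open_gt.
  by move=> z _; exact: (cs 0%N z).
- split => // z Wz; apply: KU; apply: contrapT => /bK; rewrite W1// => /eqP.
  by rewrite oner_eq0.
Qed.

End Bump.

(** * Charts and fields with prescribed values *)

Section Jacobian.
Context {R : realType}.

Lemma eq_mulmx_row m n (A B : 'M[R]_(m, n)) :
  (forall v : 'rV_m, v *m A = v *m B) -> A = B.
Proof. by move=> h; apply/row_matrixP => i; rewrite !rowE h. Qed.

Lemma mulmx_jacobian m n (f : 'rV[R]_m -> 'rV[R]_n) x v :
  v *m jacobian f x = 'd f x v.
Proof. exact: mul_rV_lin1. Qed.

Lemma jacobian_comp m n p (f : 'rV[R]_m -> 'rV[R]_n) (g : 'rV[R]_n -> 'rV[R]_p) x :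
  differentiable f x -> differentiable g (f x) ->
  jacobian (g \o f) x = jacobian f x *m jacobian g (f x).
Proof.
move=> df dg; apply: eq_mulmx_row => v; rewrite mulmxA 3!mulmx_jacobian.
exact: (congr1 (fun h => h _) (diff_comp df dg)).
Qed.

Lemma near_jacobian m n (f g : 'rV[R]_m -> 'rV[R]_n) x :
  (\near x, f x = g x) -> differentiable f x -> jacobian g x = jacobian f x.
Proof.
move=> fg df; have [_ e] := near_eq_diff fg df.
apply: eq_mulmx_row => v; apply: etrans (mulmx_jacobian g x v) _.
apply: etrans _ (esym (mulmx_jacobian f x v)).
exact: (congr1 (fun h => h _) e).
Qed.

Lemma jacobian_id n (x : 'rV[R]_n) : jacobian id x = 1%:M.
Proof.
apply: eq_mulmx_row => v; rewrite mulmx_jacobian mulmx1.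
exact: (congr1 (fun h => h _) (@diff_val _ _ _ _ _ _ _ (is_diff_id x))).
Qed.

Lemma open_setI_preimage (S T : topologicalType) (A : set S) (B : set T) (f : S -> T) :
  open A -> open B -> (forall x, A x -> {for x, continuous f}) ->
  open (A `&` f @^-1` B).
Proof.
rewrite !openE => oA oB cf x [Ax Bx]; apply: filterI; first exact: oA.
exact: (cf _ Ax _ (oB _ Bx)).
Qed.

End Jacobian.

Section Charts.
Context {R : realType} {n : nat} (M : manifold R n).
Implicit Types (c : chart R n M) (x : M) (X : vfield M).

Definition transition c c' : 'rV[R]_n -> 'rV[R]_n := chart_fun c' \o chart_inv c.

Definition overlap c c' : set 'rV[R]_n := chart_img c `&` chart_inv c @^-1` chart_dom c'.

Lemma overlap_open c c' : open (overlap c c').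
Proof.
apply: open_setI_preimage; [exact: chart_img_open|exact: chart_dom_open|].
by move=> y; exact: chart_inv_cont.
Qed.

Lemma overlap_fun c c' x : chart_dom c x -> chart_dom c' x -> overlap c c' (chart_fun c x).
Proof. by move=> cx c'x; split; [exact: chart_funP|rewrite /= chart_funK]. Qed.

Lemma transition_overlap c c' y : overlap c c' y -> overlap c' c (transition c c' y).
Proof.
by move=> [iy dy]; apply: overlap_fun => //; exact: chart_invP.
Qed.

Lemma transition_fun c c' x : chart_dom c x -> transition c c' (chart_fun c x) = chart_fun c' x.
Proof. by move=> cx; rewrite /transition /= chart_funK. Qed.

Lemma chart_inv_trans c c' y : overlap c c' y -> chart_inv c' (transition c c' y) = chart_inv c y.
Proof. by move=> [iy dy]; rewrite /transition /= chart_funK. Qed.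

Lemma transition_smooth c c' : atlas c -> atlas c' -> smooth_on (overlap c c') (transition c c').
Proof. exact: atlas_smooth. Qed.

Lemma transition_differentiable c c' y : atlas c -> atlas c' -> overlap c c' y ->
  differentiable (transition c c') y.
Proof. by move=> ac ac' oy; have [+ _] := transition_smooth ac ac' 1%N; apply. Qed.

Lemma jacobian_trans c c' c'' y : atlas c -> atlas c' -> atlas c'' ->
  overlap c c' y -> overlap c c'' y ->
  jacobian (transition c c'') y = jacobian (transition c c') y *m jacobian (transition c' c'') (transition c c' y).
Proof.
move=> ac ac' ac'' o1 o2.
have o3 : overlap c' c'' (transition c c' y).
  by split; [exact: (transition_overlap o1).1|rewrite /= chart_inv_trans//; exact: o2.2].
have d1 := transition_differentiable ac ac' o1.
have d2 := transition_differentiable ac' ac'' o3.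
rewrite -(jacobian_comp d1 d2); apply: near_jacobian.
  near=> z; have oz : overlap c c' z.
    by near: z; apply: open_nbhs_nbhs; split => //; exact: overlap_open.
  by rewrite /= {1}/transition /= (chart_inv_trans oz).
exact: differentiable_comp.
Unshelve. all: by end_near. Qed.

Lemma jacobian_trans_id c y : atlas c -> chart_img c y -> jacobian (transition c c) y = 1%:M.
Proof.
move=> ac iy; rewrite -(jacobian_id y); apply: near_jacobian => //.
near=> z; rewrite /transition /= chart_invK//; near: z.
by apply: open_nbhs_nbhs; split => //; exact: chart_img_open.
Unshelve. all: by end_near. Qed.

Lemma jacobian_transK c c' y : atlas c -> atlas c' -> overlap c c' y ->
  jacobian (transition c c') y *m jacobian (transition c' c) (transition c c' y) = 1%:M.
Proof.
move=> ac ac' oy; rewrite -jacobian_trans//; first by apply: jacobian_trans_id => //; case: oy.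
by split; [case: oy|apply: chart_invP; case: oy].
Qed.

Lemma chart_at_img x : chart_img (chart_at x) (local_coord x).
Proof. by apply: chart_funP; exact: chart_at_dom. Qed.

Lemma chart_at_inv x : chart_inv (chart_at x) (local_coord x) = x.
Proof. by apply: chart_funK; exact: chart_at_dom. Qed.

Lemma tcoord_at x : tcoord (chart_at x) x = 1%:M.
Proof.
by apply: jacobian_trans_id; [exact: chart_at_atlas|exact: chart_at_img].
Qed.

(** The Jacobian of a composition, read as a change of basis. *)
Lemma tcoord_trans c c' x : atlas c -> atlas c' -> chart_dom c x -> chart_dom c' x ->
  tcoord c' x = tcoord c x *m jacobian (transition c c') (chart_fun c x).
Proof.
move=> ac ac' cx c'x; rewrite /tcoord.
have o1 := overlap_fun (chart_at_dom x) cx; have o2 := overlap_fun (chart_at_dom x) c'x.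
rewrite (jacobian_trans (chart_at_atlas x) ac ac' o1 o2).
by rewrite transition_fun//; exact: chart_at_dom.
Qed.

Lemma tcoord_unit c x : atlas c -> chart_dom c x -> tcoord c x \in unitmx.
Proof.
move=> ac cx; have o1 := overlap_fun (chart_at_dom x) cx.
have [h _] := mulmx1_unit (jacobian_transK (chart_at_atlas x) ac o1).
exact: h.
Qed.

Lemma vf_coord_at X x : vf_coord (chart_at x) X (local_coord x) = X x.
Proof. by rewrite /vf_coord chart_at_inv tcoord_at mulmx1. Qed.

Lemma vf_coord_trans c c' X y : atlas c -> atlas c' -> overlap c c' y ->
  vf_coord c' X (transition c c' y) = vf_coord c X y *m jacobian (transition c c') y.
Proof.
move=> ac ac' oy; have [iy dy] := oy.
rewrite /vf_coord (chart_inv_trans oy) -mulmxA.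
by rewrite (tcoord_trans ac ac' (chart_invP iy) dy) (chart_invK iy).
Qed.

(** Smoothness needs to be tested in one chart around each point only, since
    the transition maps carry it over to every other chart. *)
Lemma smooth_vf_local X :
  (forall x, exists c U, [/\ atlas c, chart_dom c x, open U, U (chart_fun c x) &
     smooth_on U (vf_coord c X)]) -> smooth_vf X.
Proof.
move=> h c' ac' k; apply: Ck_local => y' iy'.
have [c [U [ac cx oU Ux sU]]] := h (chart_inv c' y').
have oy' : overlap c' c y' by split.
pose W := overlap c' c `&` transition c' c @^-1` U.
have oW : open W.
  apply: open_setI_preimage; [exact: overlap_open|exact: oU|].
  move=> z oz; exact: differentiable_continuous (transition_differentiable ac' ac oz).
exists W; first by split.
pose U' := U `&` overlap c c'.
have oU' : open U' by apply: openI => //; exact: overlap_open.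
have fU z : W z -> U' (transition c' c z) by move=> [oz Uz]; split => //; exact: transition_overlap.
have c1 : Ck_on k W (transition c' c).
  by apply: (Ck_subset _ (transition_smooth ac' ac k)) => z [].
have c2 : Ck_on k U' (fun y => vf_coord c X y *m jacobian (transition c c') y).
  apply: Ck_mulmx => //; first by apply: (Ck_subset _ (sU k)) => z [].
  apply: Ck_jacobian => //.
  by apply: (Ck_subset _ (transition_smooth ac ac' k.+1)) => z [].
apply: (eq_Ck oW _ (Ck_comp oW oU' fU c1 c2)) => z [oz Uz].
rewrite -(vf_coord_trans X ac ac' (transition_overlap oz)).
by rewrite {1}/transition /= (chart_inv_trans oz) chart_invK//; case: oz.
Qed.

Lemma smooth_fun_local (f : M -> R) :
  (forall x, exists c U, [/\ atlas c, chart_dom c x, open U, U (chart_fun c x) &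
     smooth_on U (f \o chart_inv c : _ -> R^o)]) -> smooth_fun f.
Proof.
move=> h c' ac' k; apply: Ck_local => y' iy'.
have [c [U [ac cx oU Ux sU]]] := h (chart_inv c' y').
pose W := overlap c' c `&` transition c' c @^-1` U.
have oW : open W.
  apply: open_setI_preimage; [exact: overlap_open|exact: oU|].
  move=> z oz; exact: differentiable_continuous (transition_differentiable ac' ac oz).
exists W; first by split.
have fU z : W z -> U (transition c' c z) by move=> [].
have c1 : Ck_on k W (transition c' c).
  by apply: (Ck_subset _ (transition_smooth ac' ac k)) => z [].
apply: (eq_Ck oW _ (Ck_comp_scalar oW oU fU c1 (sU k))) => z [oz Uz].
by rewrite /= chart_inv_trans.
Qed.

(** Take the field with constant components v in chart_at p, cut off by a bump
    function. Outside the domain of the chart it is smooth because the bump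
    function vanishes outside the image of a compact set, which is closed: this
    is where the Hausdorff property enters. *)
Lemma const_field_exists (p : M) :
  exists e : 'rV[R]_n -> vfield M,
  (forall v, smooth_vf (e v)) /\
  (exists W, [/\ open W, W (local_coord p), W `<=` chart_img (chart_at p) &
        forall v y, W y -> vf_coord (chart_at p) (e v) y = v]).
Proof.
set c := chart_at p; have ac : atlas c := chart_at_atlas p.
have [b [K [W [sb [cK KU] bK [oW Wp] [WU W1]]]]] :=
  bump_rV (@chart_img_open _ _ _ c) (chart_at_img p).
pose e (v : 'rV[R]_n) : vfield M := fun x =>
  if x \in chart_dom c then b (chart_fun c x) *: (v *m invmx (tcoord c x)) else 0.
have ve v y : chart_img c y -> vf_coord c (e v) y = b y *: v.
  move=> iy; have dy := chart_invP iy.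
  rewrite /vf_coord /e mem_set// chart_invK// -scalemxAl mulmxKV//.
  exact: tcoord_unit.
exists e; split.
- move=> v; apply: smooth_vf_local => x.
  have [cx|ncx] := pselect (chart_dom c x).
    exists c, (chart_img c); split => //.
    + exact: chart_img_open.
    + exact: chart_funP.
    + move=> k; have oI := @chart_img_open _ _ _ c.
      have c1 : Ck_on k (chart_img c) b by apply: (Ck_subset _ (sb k)).
      by apply: (eq_Ck oI _ (Ck_scale oI c1 (Ck_cst _ _ v))) => y iy; rewrite ve.
  have clK : closed (chart_inv c @` K).
    apply: compact_closed; first exact: manifold_hausdorff.
    apply: continuous_compact => //; apply: continuous_in_subspaceT => y /set_mem /KU.
    exact: chart_inv_cont.
  pose c' := chart_at x; have ac' : atlas c' := chart_at_atlas x.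
  pose U := chart_img c' `&` chart_inv c' @^-1` (~` (chart_inv c @` K)).
  exists c', U; split => //.
  + exact: chart_at_dom.
  + apply: open_setI_preimage; [exact: chart_img_open|exact: closed_openC|].
    by move=> y; exact: chart_inv_cont.
  + split; first exact: chart_at_img.
    rewrite /= chart_at_inv => -[y /KU iy exy]; apply: ncx; rewrite -exy.
    exact: chart_invP.
  + move=> k.
    have oU : open U.
      apply: open_setI_preimage; [exact: chart_img_open|exact: closed_openC|].
      by move=> y; exact: chart_inv_cont.
    apply: (eq_Ck oU _ (Ck_cst k U 0)) => y [iy nK].
    rewrite /vf_coord /e; case: ifPn => [/set_mem dy|_]; last by rewrite mul0mx.
    rewrite bK ?scale0r ?mul0mx// => Kf; apply: nK; exists (chart_fun c (chart_inv c' y)) => //.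
    exact: chart_funK.
- exists W; split => // v y Wy; rewrite ve ?W1 ?scale1r//; exact: WU.
Qed.

(** Global extension of a tangent vector at p whose components in chart_at p
    are constant near p. Tensorial identities at p can be tested on such
    fields, whose brackets vanish at p. *)
Definition const_field (p : M) : 'rV[R]_n -> vfield M := sval (cid (const_field_exists p)).

Lemma const_field_smooth p v : smooth_vf (const_field p v).
Proof. by rewrite /const_field; case: cid => e /= []. Qed.

Lemma const_field_near p : exists W, [/\ open W, W (local_coord p),
  W `<=` chart_img (chart_at p) &
  forall v y, W y -> vf_coord (chart_at p) (const_field p v) y = v].
Proof. by rewrite /const_field; case: cid => e /= []. Qed.

Lemma const_field_at p v : const_field p v p = v.
Proof.
by have [W [_ Wp _ h]] := const_field_near p; rewrite -[LHS]vf_coord_at h.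
Qed.

End Charts.

(** * Smooth tensor fields *)

Section SmoothFields.
Context {R : realType} {n : nat} (M : manifold R n).
Implicit Types (X Y Z V : vfield M) (f : M -> R) (B : biform M) (p x : M).

Lemma smooth_fun_cst a : smooth_fun (fun _ : M => a).
Proof. by move=> c _ k; exact: (Ck_cst k (chart_img c) (a : R^o)). Qed.

Lemma smooth_vf_add X Y : smooth_vf X -> smooth_vf Y -> smooth_vf (X + Y).
Proof.
move=> sX sY c ac k; have oI := @chart_img_open _ _ _ c.
apply: (eq_Ck oI _ (Ck_add oI (sX c ac k) (sY c ac k))) => y _.
by rewrite /vf_coord fctE /= mulmxDl.
Qed.

Lemma smooth_vf_scale f X : smooth_fun f -> smooth_vf X -> smooth_vf (scalev f X).
Proof.
move=> sf sX c ac k; have oI := @chart_img_open _ _ _ c.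
apply: (eq_Ck oI _ (Ck_scale oI (sf c ac k) (sX c ac k))) => y _.
by rewrite /vf_coord /scalev -scalemxAl.
Qed.

Lemma smooth_vf_sub X Y : smooth_vf X -> smooth_vf Y -> smooth_vf (X - Y).
Proof.
move=> sX sY; have -> : X - Y = X + scalev (fun=> -1) Y.
  by apply/funext => x; rewrite /scalev !fctE /= scaleN1r.
by apply: smooth_vf_add => //; apply: smooth_vf_scale => //; exact: smooth_fun_cst.
Qed.

Definition smooth_biform B : Prop :=
  forall X Y, smooth_vf X -> smooth_vf Y -> smooth_fun (eval_form B X Y).

(** Near p, the Gram matrix of B in the coordinates of chart_at p; defined
    through global fields so that its smoothness is inherited from that of B
    on global fields. *)
Definition gram B p (y : 'rV[R]_n) : 'M[R]_n :=
  \matrix_(i, j) eval_form B (const_field p (delta_mx 0 i)) (const_field p (delta_mx 0 j))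
    (chart_inv (chart_at p) y).

Definition const_nbhd p (W : set 'rV[R]_n) :=
  [/\ open W, W (local_coord p), W `<=` chart_img (chart_at p) &
  forall v y, W y -> vf_coord (chart_at p) (const_field p v) y = v].

Lemma delta_form m (A : 'M[R]_m) i j : ((delta_mx 0 i : 'rV[R]_m) *m A *m (delta_mx 0 j : 'rV[R]_m)^T) 0 0 = A i j.
Proof. by rewrite -rowE trmx_delta -colE !mxE. Qed.

Lemma const_field_inv p W : const_nbhd p W -> forall v y, W y ->
  const_field p v (chart_inv (chart_at p) y) =
  v *m invmx (tcoord (chart_at p) (chart_inv (chart_at p) y)).
Proof.
move=> [oW Wp WI hW] v y Wy; have := hW v y Wy; rewrite /vf_coord => e.
have u := tcoord_unit (chart_at_atlas p) (chart_invP (WI _ Wy)).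
by rewrite -{2}e mulmxK.
Qed.

Lemma gramE B p W : const_nbhd p W -> forall y, W y ->
  let q := chart_inv (chart_at p) y in let T := tcoord (chart_at p) q in
  gram B p y = invmx T *m B q *m (invmx T)^T.
Proof.
move=> fW y Wy q T; apply/matrixP => i j; rewrite mxE /eval_form /form_at.
rewrite !(const_field_inv fW _ Wy) -delta_form trmx_mul !mulmxA.
by [].
Qed.

Lemma form_gram B p W : const_nbhd p W -> forall y, W y ->
  let q := chart_inv (chart_at p) y in let T := tcoord (chart_at p) q in
  forall u v, form_at (B q) u v = ((u *m T) *m gram B p y *m (v *m T)^T) 0 0.
Proof.
move=> fW y Wy q T u v; have [oW Wp WI hW] := fW.
have uT : T \in unitmx by exact: tcoord_unit (chart_at_atlas p) (chart_invP (WI _ Wy)).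
rewrite (gramE B fW Wy) -/q -/T /form_at trmx_mul !mulmxA mulmxK//.
rewrite -[_ *m _ *m T^T]mulmxA -trmx_mul mulmxV// trmx1 mulmx1.
by [].
Qed.

Lemma gram_smooth B p W k : const_nbhd p W -> smooth_biform B -> Ck_on k W (gram B p).
Proof.
move=> [oW Wp WI hW] sB; apply/(Ck_entries k _ oW) => i j.
have sij := sB _ _ (const_field_smooth p (delta_mx 0 i)) (const_field_smooth p (delta_mx 0 j)).
have := Ck_subset WI (sij _ (chart_at_atlas p) k).
by apply: (eq_Ck oW) => y _; rewrite mxE.
Qed.

(** In a local frame the components of V are obtained from the functions
    B(V, e_j) by inverting the Gram matrix of B. This yields the smoothness of
    raised 1-forms and of inverses of fields of endomorphisms. *)
Lemma solve_smooth B V : nondegenerate_form B -> smooth_biform B ->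
  (forall Y, smooth_vf Y -> smooth_fun (eval_form B V Y)) -> smooth_vf V.
Proof.
move=> nB sB sV; apply: smooth_vf_local => p.
have [W fW] : exists W, const_nbhd p W by exact: const_field_near.
have [oW Wp WI hW] := fW.
exists (chart_at p), W; split => //; [exact: chart_at_atlas|exact: chart_at_dom|].
move=> k.
pose f y : 'rV[R]_n := \row_j eval_form B V (const_field p (delta_mx 0 j)) (chart_inv (chart_at p) y).
have cf : Ck_on k W f.
  apply/(Ck_entries k _ oW) => i j.
  have := Ck_subset WI (sV _ (const_field_smooth p (delta_mx 0 j)) _ (chart_at_atlas p) k).
  by apply: (eq_Ck oW) => y _; rewrite mxE.
have cG := gram_smooth k fW sB.
have uT y : W y -> tcoord (chart_at p) (chart_inv (chart_at p) y) \in unitmx.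
  by move=> Wy; exact: tcoord_unit (chart_at_atlas p) (chart_invP (WI _ Wy)).
have uG y : W y -> gram B p y \in unitmx.
  move=> Wy; rewrite (gramE B fW Wy) !unitmx_mul unitmx_tr !unitmx_inv uT//=.
  by rewrite nB.
apply: (eq_Ck oW _ (Ck_mulmx oW cf (Ck_invmx oW uG cG))) => y Wy.
have -> : f y = vf_coord (chart_at p) V y *m gram B p y.
  apply/rowP => j; rewrite mxE /eval_form (form_gram B fW Wy).
  have e := hW (delta_mx 0 j) _ Wy; rewrite /vf_coord in e.
  by rewrite e trmx_delta -colE !mxE.
by rewrite mulmxK// uG.
Qed.

End SmoothFields.

(** * Pulling back along an immersion *)

Section Immersion.
Context {R : realType} {n m : nat} (N : manifold R n) (M : manifold R m).
Variables (i : N -> M) (si : smooth_map i).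
Implicit Types (X Y Z : vfield N) (B : biform M) (x : N).

Definition loc_map (c : chart R n N) (c' : chart R m M) : 'rV[R]_n -> 'rV[R]_m :=
  chart_fun c' \o i \o chart_inv c.

Definition loc_dom (c : chart R n N) (c' : chart R m M) : set 'rV[R]_n :=
  chart_img c `&` (i \o chart_inv c) @^-1` chart_dom c'.

Lemma loc_dom_open c c' : open (loc_dom c c').
Proof.
apply: open_setI_preimage; [exact: chart_img_open|exact: chart_dom_open|].
move=> y iy; apply: continuous_comp; first exact: chart_inv_cont.
exact: si.1.
Qed.

Lemma loc_map_smooth c c' : atlas c -> atlas c' -> smooth_on (loc_dom c c') (loc_map c c').
Proof. exact: si.2. Qed.

Lemma loc_map_differentiable c c' y : atlas c -> atlas c' -> loc_dom c c' y ->
  differentiable (loc_map c c') y.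
Proof. by move=> ac ac' oy; have [+ _] := loc_map_smooth ac ac' 1%N; apply. Qed.

(** The chain rule, applied to the two ways of writing i in the preferred
    chart at x and in c'. *)
Lemma tangent_map_tcoord c c' y : atlas c -> atlas c' -> loc_dom c c' y ->
  let x := chart_inv c y in
  tcoord c x *m jacobian (loc_map c c') y = tangent_map i x *m tcoord c' (i x).
Proof.
move=> ac ac' oy x; have [iy dy] := oy.
set c1 := chart_at x; set c2 := chart_at (i x); set y1 := local_coord x.
have ac1 : atlas c1 by exact: chart_at_atlas.
have ac2 : atlas c2 by exact: chart_at_atlas.
have x1 : chart_inv c1 y1 = x by exact: chart_at_inv.
have dx : chart_dom c x by exact: chart_invP.
have o1 : overlap c1 c y1 by exact: overlap_fun (chart_at_dom x) dx.
have t1 : transition c1 c y1 = y by rewrite /transition /= x1 chart_invK.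
have l1 : loc_dom c1 c2 y1.
  by split; [exact: chart_at_img|rewrite /= x1; exact: chart_at_dom].
have l2 : loc_map c1 c2 y1 = local_coord (i x) by rewrite /loc_map /= x1.
have l3 : loc_dom c1 c' y1 by split; [exact: chart_at_img|rewrite /= x1].
have d1 := transition_differentiable ac1 ac o1.
have d2 : differentiable (loc_map c c') (transition c1 c y1).
  by rewrite t1; exact: loc_map_differentiable.
have d3 := loc_map_differentiable ac1 ac2 l1.
have o4 : overlap c2 c' (loc_map c1 c2 y1).
  by rewrite l2; exact: overlap_fun (chart_at_dom (i x)) dy.
have d4 := transition_differentiable ac2 ac' o4.
have dd := loc_map_differentiable ac1 ac' l3.
have e1 : jacobian (loc_map c c' \o transition c1 c) y1 = jacobian (loc_map c1 c') y1.
  apply: near_jacobian dd.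
  near=> z; have oz : overlap c1 c z.
    by near: z; apply: open_nbhs_nbhs; split; [exact: overlap_open|exact: o1].
  by rewrite /loc_map /= chart_inv_trans.
have e2 : jacobian (transition c2 c' \o loc_map c1 c2) y1 = jacobian (loc_map c1 c') y1.
  apply: near_jacobian dd.
  near=> z; have [iz dz] : loc_dom c1 c2 z.
    by near: z; apply: open_nbhs_nbhs; split; [exact: loc_dom_open|exact: l1].
  by rewrite /loc_map /transition /= chart_funK.
apply: etrans (etrans (etrans _ e1) (esym e2)) _.
  by rewrite (jacobian_comp d1 d2) t1.
by rewrite (jacobian_comp d3 d4) l2.
Unshelve. all: by end_near. Qed.

Lemma eval_induced B X Y x :
  eval_form (induced_metric i B) X Y x =
  form_at (B (i x)) (X x *m tangent_map i x) (Y x *m tangent_map i x).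
Proof. by rewrite /eval_form /induced_metric /form_at trmx_mul !mulmxA. Qed.

Section AtPoint.
Variables (x0 : N) (W : set 'rV[R]_m).
Let p := i x0.
Let c := chart_at x0.
Let c' := chart_at p.
Hypothesis fW : const_nbhd p W.

Definition pull_dom : set 'rV[R]_n := loc_dom c c' `&` loc_map c c' @^-1` W.

(** The field i_* Y along i near x0, in the coordinates of chart_at (i x0). It
    is a vector-valued function on an open set of coordinates of N, and so can
    be differentiated although it need not extend to a field on M. *)
Definition push (Y : vfield N) (y : 'rV[R]_n) : 'rV[R]_m :=
  vf_coord c Y y *m jacobian (loc_map c c') y.

Let ac : atlas c := chart_at_atlas x0.
Let ac' : atlas c' := chart_at_atlas p.

Lemma pull_dom_open : open pull_dom.
Proof.
have [oW _ _ _] := fW.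
apply: open_setI_preimage; [exact: loc_dom_open|exact: oW|].
by move=> y ly; exact: differentiable_continuous (loc_map_differentiable ac ac' ly).
Qed.

Lemma pull_dom_at : pull_dom (local_coord x0).
Proof.
have [_ Wp _ _] := fW; split; last by rewrite /loc_map /= chart_at_inv.
by split; [exact: chart_at_img|rewrite /= chart_at_inv; exact: chart_at_dom].
Qed.

Lemma loc_map_Ck k : Ck_on k pull_dom (loc_map c c').
Proof. by apply: Ck_subset (loc_map_smooth ac ac' k) => y []. Qed.

Lemma push_Ck Y k : smooth_vf Y -> Ck_on k pull_dom (push Y).
Proof.
move=> sY; apply: Ck_mulmx; [exact: pull_dom_open| |].
  by apply: Ck_subset (sY _ ac k) => y [[]].
by apply: Ck_jacobian; [exact: pull_dom_open|exact: loc_map_Ck].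
Qed.

Lemma pushE Y y : pull_dom y ->
  push Y y = Y (chart_inv c y) *m tangent_map i (chart_inv c y)
             *m tcoord c' (i (chart_inv c y)).
Proof.
move=> [ly _]; rewrite /push /vf_coord -!mulmxA.
by congr (_ *m _); exact: tangent_map_tcoord.
Qed.

Lemma push_at Y : push Y (local_coord x0) = Y x0 *m tangent_map i x0.
Proof. by rewrite /push vf_coord_at. Qed.

Lemma induced_local B Y Z y : pull_dom y ->
  eval_form (induced_metric i B) Y Z (chart_inv c y) =
  (push Y y *m gram B p (loc_map c c' y) *m (push Z y)^T) 0 0.
Proof.
move=> oy; have [[iy dy] Wy] := oy; rewrite eval_induced.
have eq : i (chart_inv c y) = chart_inv c' (loc_map c c' y).
  by rewrite /loc_map /= chart_funK.
have e := form_gram B fW Wy (Y (chart_inv c y) *m tangent_map i (chart_inv c y))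
  (Z (chart_inv c y) *m tangent_map i (chart_inv c y)).
rewrite -eq in e; apply: etrans e _.
exact: (congr2 (fun u v : 'rV_m => (u *m gram B p (loc_map c c' y) *m v^T) 0 0)
  (esym (pushE Y oy)) (esym (pushE Z oy))).
Qed.

Lemma induced_Ck B Y Z k : smooth_biform B -> smooth_vf Y -> smooth_vf Z ->
  Ck_on k pull_dom (eval_form (induced_metric i B) Y Z \o chart_inv c : _ -> R^o).
Proof.
move=> sB sY sZ; have oP := pull_dom_open; have [oW _ _ _] := fW.
have fP y : pull_dom y -> W (loc_map c c' y) by case.
have cG := Ck_comp oP oW fP (loc_map_Ck k) (gram_smooth k fW sB).
have cF := Ck_mulmx oP (Ck_mulmx oP (push_Ck k sY) cG) (Ck_tr oP (push_Ck k sZ)).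
have /(Ck_entries k _ oP)/(_ 0 0) := cF.
by apply: (eq_Ck oP) => y oy; rewrite /= induced_local.
Qed.

End AtPoint.

Lemma induced_smooth B : smooth_biform B -> smooth_biform (induced_metric i B).
Proof.
move=> sB Y Z sY sZ; apply: smooth_fun_local => x.
have [W fW] : exists W, const_nbhd (i x) W by exact: const_field_near.
exists (chart_at x), (pull_dom x W); split.
- exact: chart_at_atlas.
- exact: chart_at_dom.
- exact: pull_dom_open.
- exact: pull_dom_at.
- by move=> k; exact: induced_Ck.
Qed.

End Immersion.

(** * The Gauss formula *)

Section FormAt.
Context {R : realType} {n : nat}.
Implicit Types (G : 'M[R]_n) (u v w : 'rV[R]_n).

Lemma form_atDl G u v w : form_at G (u + v) w = form_at G u w + form_at G v w.
Proof. by rewrite /form_at !mulmxDl mxE. Qed.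

Lemma form_atDr G u v w : form_at G u (v + w) = form_at G u v + form_at G u w.
Proof. by rewrite /form_at linearD mulmxDr mxE. Qed.

Lemma form_atZl G a u v : form_at G (a *: u) v = a * form_at G u v.
Proof. by rewrite /form_at -!scalemxAl mxE. Qed.

Lemma form_atZr G a u v : form_at G u (a *: v) = a * form_at G u v.
Proof. by rewrite /form_at linearZ -scalemxAr mxE. Qed.

Lemma form_atNl G u v : form_at G (- u) v = - form_at G u v.
Proof. by rewrite -scaleN1r form_atZl mulN1r. Qed.

Lemma form_atNr G u v : form_at G u (- v) = - form_at G u v.
Proof. by rewrite -scaleN1r form_atZr mulN1r. Qed.

Lemma form_atBl G u v w : form_at G (u - v) w = form_at G u w - form_at G v w.
Proof. by rewrite form_atDl form_atNl. Qed.

Lemma form_atC G u v : G^T = G -> form_at G u v = form_at G v u.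
Proof.
move=> sG; have -> : form_at G v u = (v *m G *m u^T)^T 0 0 by rewrite mxE.
by rewrite !trmx_mul trmxK sG mulmxA.
Qed.

Lemma form_at_nondegenerate G u v : G \in unitmx -> (forall w, form_at G u w = form_at G v w) -> u = v.
Proof.
move=> uG h; apply: (can_inj (mulmxK uG)); apply/rowP => j.
by have := h (delta_mx 0 j); rewrite /form_at trmx_delta -!colE !mxE.
Qed.

End FormAt.

(** The permutation argument behind the uniqueness of the Levi-Civita
    connection. *)
Lemma sym_skew_eq0 (R : realType) (T : Type) (P : T -> Prop) (q : T -> T -> T -> R) :
  (forall x y z, P x -> P y -> P z -> q x y z = q y x z) ->
  (forall x y z, P x -> P y -> P z -> q x y z = - q x z y) ->
  forall x y z, P x -> P y -> P z -> q x y z = 0.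
Proof.
move=> s k x y z Px Py Pz; have : q x y z = - q x y z; last lra.
by rewrite {1}s// k// (s y z x)// (k z y x)// opprK (s z x y)// k.
Qed.

Section Gauss.
Context {R : realType} {n m : nat} (N : manifold R n) (M : manifold R m).
Variables (i : N -> M) (si : smooth_map i) (x0 : N).
Implicit Types (X Y Z : vfield N) (B : biform M).

Let p := i x0.
Let c := chart_at x0.
Let c' := chart_at p.
Let y0 := local_coord x0.
Let J := tangent_map i x0.

Definition dpush X Y : 'rV[R]_m := 'D_(X x0) (push i x0 Y) y0.

Lemma gram_at B W : const_nbhd p W -> gram B p (local_coord p) = B p.
Proof.
move=> fW; have [_ Wp _ _] := fW.
by rewrite (gramE B fW Wp) chart_at_inv tcoord_at invmx1 trmx1 mul1mx mulmx1.
Qed.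

Lemma loc_map_at : loc_map i c c' y0 = local_coord p.
Proof. by rewrite /loc_map /= chart_at_inv. Qed.

(** Product rule; the derivative of the coefficients of B along i_* X is
    recorded as a derivative of B on fields with constant components. *)
Lemma vf_deriv_induced B X Y Z : smooth_biform B ->
  smooth_vf X -> smooth_vf Y -> smooth_vf Z ->
  vf_deriv X (eval_form (induced_metric i B) Y Z) x0 =
  form_at (B p) (dpush X Y) (Z x0 *m J) + form_at (B p) (Y x0 *m J) (dpush X Z) +
  vf_deriv (const_field p (X x0 *m J)) (eval_form B (const_field p (Y x0 *m J)) (const_field p (Z x0 *m J))) p.
Proof.
move=> sB sX sY sZ.
have [W fW] : exists W, const_nbhd p W by exact: const_field_near.
have [oW Wp WI hW] := fW.
have oP := pull_dom_open si fW; have P0 := pull_dom_at fW.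
set v := X x0.
set u := Y x0 *m J; set w := Z x0 *m J.
have dY : derivable (push i x0 Y) y0 v := Ck_derivable (push_Ck si fW 1 sY) P0.
have dZ : derivable (push i x0 Z) y0 v := Ck_derivable (push_Ck si fW 1 sZ) P0.
have dphi : differentiable (loc_map i c c') y0.
  by have [+ _] := loc_map_Ck si x0 W 1; apply.
have cG := gram_smooth 1 fW sB.
have dG : differentiable (gram B p) (loc_map i c c' y0).
  by rewrite loc_map_at; have [+ _] := cG; apply.
pose G y := gram B p (loc_map i c c' y).
have dGp : differentiable G y0 := differentiable_comp dphi dG.
have dGd : derivable G y0 v := diff_derivable dGp.
have eG : 'D_v G y0 = 'D_(v *m J) (gram B p) (local_coord p).
  apply: etrans (deriveE v dGp) _.
  apply: etrans (congr1 (fun h => h v) (diff_comp dphi dG)) _.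
  rewrite -loc_map_at; apply: etrans (esym (deriveE _ dG)).
  exact: (congr1 (fun z => 'd (gram B p) (loc_map i c c' y0) z) (esym (mulmx_jacobian (loc_map i c c') y0 v))).
pose F y := push i x0 Y y *m G y *m (push i x0 Z y)^T.
have [dYG eYG] := derivable_mulmx dY dGd.
have [dZt eZt] := derivable_tr dZ.
have [dF eF] := derivable_mulmx dYG dZt.
have -> : vf_deriv X (eval_form (induced_metric i B) Y Z) x0 = ('D_v F y0) 0 0.
  apply: etrans _ (esym (derive_entry 0 0 dF)).
  apply: near_eq_derive; near=> y.
  have Py : pull_dom i x0 W y.
    by near: y; apply: open_nbhs_nbhs; split; [exact: oP|exact: P0].
  exact: (induced_local si fW B Y Z Py).
have -> : vf_deriv (const_field p (v *m J)) (eval_form B (const_field p u) (const_field p w)) p =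
    (u *m 'D_(v *m J) (gram B p) (local_coord p) *m w^T) 0 0.
  have d1 : derivable (gram B p) (local_coord p) (v *m J) := Ck_derivable cG Wp.
  have [d2 e2] := derivable_mulmx (derivable_cst u (local_coord p) (v *m J)) d1.
  have [d3 e3] := derivable_mulmx d2 (derivable_cst w^T (local_coord p) (v *m J)).
  rewrite /vf_deriv const_field_at.
  have -> : u *m 'D_(v *m J) (gram B p) (local_coord p) *m w^T =
     'D_(v *m J) (fun z => u *m gram B p z *m w^T) (local_coord p).
    apply: esym; apply: etrans e3 _.
    rewrite e2 !derive_cst mulmx0 addr0.
    by congr (_ *m _); rewrite mul0mx add0r.
  apply: etrans _ (esym (derive_entry 0 0 d3)).
  apply: near_eq_derive; near=> z.
  have Wz : W z by near: z; apply: open_nbhs_nbhs; split; [exact: oW|exact: Wp].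
  have e := form_gram B fW Wz (const_field p u (chart_inv c' z)) (const_field p w (chart_inv c' z)).
  have eu := hW u _ Wz; have ew := hW w _ Wz; rewrite /vf_coord in eu ew.
  by rewrite eu ew in e.
rewrite eF eYG eZt eG /G loc_map_at (gram_at B fW) /form_at /dpush /u /w.
rewrite -(push_at i x0 Y) -(push_at i x0 Z) mulmxDl !mxE.
rewrite -!addrA; congr (_ + _); by rewrite addrC.
Unshelve. all: by end_near. Qed.

(** i_* X and i_* Y involve first derivatives of i, whose own derivatives
    cancel in the commutator by the symmetry of second derivatives. *)
Lemma bracket_push X Y : smooth_vf X -> smooth_vf Y ->
  bracket X Y x0 *m J = dpush X Y - dpush Y X.
Proof.
move=> sX sY.
have [W fW] : exists W, const_nbhd p W by exact: const_field_near.
have oP := pull_dom_open si fW; have P0 := pull_dom_at fW.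
have cphi := loc_map_Ck si x0 W 2.
have cJ := Ck_jacobian oP cphi.
have oI := @chart_img_open _ _ _ c.
have key Z v : smooth_vf Z ->
    'D_v (push i x0 Z) y0 = 'D_v (vf_coord c Z) y0 *m J + 'D_v ('D_(Z x0) (loc_map i c c')) y0.
  move=> sZ.
  have d1 : derivable (vf_coord c Z) y0 v :=
    Ck_derivable (sZ _ (chart_at_atlas x0) 1%N) (chart_at_img x0).
  have d2 : derivable (fun y => jacobian (loc_map i c c') y) y0 v := Ck_derivable cJ P0.
  have [d3 e3] := derivable_mulmx d1 d2.
  apply: etrans e3 _; congr (_ + _).
  have [d4 e4] := derivable_mulmx (derivable_cst (Z x0) y0 v) d2.
  rewrite derive_cst mul0mx add0r in e4.
  rewrite vf_coord_at; apply: etrans (esym e4) _.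
  apply: near_eq_derive; near=> y.
  have Py : pull_dom i x0 W y.
    by near: y; apply: open_nbhs_nbhs; split; [exact: oP|exact: P0].
  apply: etrans (mulmx_jacobian _ _ _) (esym (deriveE _ _)).
  by have [+ _] := cphi; apply.
have sw : 'D_(X x0) ('D_(Y x0) (loc_map i c c')) y0 = 'D_(Y x0) ('D_(X x0) (loc_map i c c')) y0.
  exact: schwarz_derive oP cphi P0.
have alg (a b s : 'rV[R]_m) : a - b = (a + s) - (b + s).
  by rewrite opprD addrACA subrr addr0.
rewrite /bracket mulmxBl.
apply: etrans (alg _ _ ('D_(Y x0) ('D_(X x0) (loc_map i c c')) y0)) _.
exact: (congr2 (fun a b => a - b) (esym (etrans (key Y _ sY) (congr1 (+%R _) sw))) (esym (key X _ sX))).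
Unshelve. all: by end_near. Qed.

End Gauss.

Section BracketExt.
Context {R : realType} {m : nat} (M : manifold R m).

Lemma bracket_const_field (p : M) u v : bracket (const_field p u) (const_field p v) p = 0.
Proof.
have [W [oW Wp _ hW]] := const_field_near p.
have key w z : 'D_z (vf_coord (chart_at p) (const_field p w)) (local_coord p) = 0.
  rewrite -(derive_cst w (local_coord p) z); apply: near_eq_derive; near=> y.
  by apply: hW; near: y; apply: open_nbhs_nbhs; split; [exact: oW|exact: Wp].
by rewrite /bracket !const_field_at !key subr0.
Unshelve. all: by end_near. Qed.

End BracketExt.

Section Gauss2.
Context {R : realType} {n m : nat} (N : manifold R n) (M : manifold R m).
Variables (i : N -> M) (si : smooth_map i).
Variables (gt : biform M) (mg : metric gt) (Dm : connection M) (lm : levi_civita gt Dm).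
Variables (D : connection N) (lc : levi_civita (induced_metric i gt) D).

(** The induced connection is the tangential part of the ambient one, applied
    to the field i_* Y along i: the ambient derivative of such a field splits
    into the derivative of its components, dpush, and the ambient derivative of
    a field with constant components. The difference of the two sides is
    symmetric in X, Y because both connections are torsion-free, and
    skew-symmetric in Y, Z because both are metric. *)
Lemma gauss (x0 : N) (X Y Z : vfield N) :
  smooth_vf X -> smooth_vf Y -> smooth_vf Z ->
  let J := tangent_map i x0 in let p := i x0 in
  eval_form (induced_metric i gt) (nabla D X Y) Z x0 =
  form_at (gt p) (dpush i x0 X Y + nabla Dm (const_field p (X x0 *m J)) (const_field p (Y x0 *m J)) p)
    (Z x0 *m J).
Proof.
move=> sX sY sZ J p; have [symg ndg sg] := mg.
pose q X Y Z := eval_form (induced_metric i gt) (nabla D X Y) Z x0 -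
  form_at (gt p) (dpush i x0 X Y + nabla Dm (const_field p (X x0 *m J)) (const_field p (Y x0 *m J)) p)
    (Z x0 *m J).
apply/eqP; rewrite -subr_eq0; apply/eqP; rewrite -/(q X Y Z).
apply: (@sym_skew_eq0 R _ (@smooth_vf _ _ N) q) => //.
- move=> {}X {}Y {}Z {}sX {}sY {}sZ; apply/eqP; rewrite -subr_eq0; apply/eqP.
  have eb := lc_torsion_free lc sX sY x0; rewrite !fctE in eb.
  have tM := lc_torsion_free lm (const_field_smooth p (X x0 *m J)) (const_field_smooth p (Y x0 *m J)) p.
  rewrite bracket_const_field !fctE in tM.
  have bp := bracket_push si x0 sX sY.
  rewrite /q !eval_induced -/p -/J.
  set a := nabla D X Y x0 in eb *; set b := nabla D Y X x0 in eb *.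
  set s := nabla Dm _ _ p in tM *; set t := nabla Dm _ _ p in tM *.
  have -> : s = t by apply/eqP; rewrite -subr_eq0 tM.
  rewrite -eb mulmxBl -/J in bp.
  set w := Z x0 *m J.
  set d1 := dpush i x0 X Y in bp *; set d2 := dpush i x0 Y X in bp *.
  clear eb tM; clearbody w s t d1 d2 a b.
  have := congr1 (form_at (gt p) ^~ w) bp; rewrite /= !form_atBl !form_atDl.
  lra.
- move=> {}X {}Y {}Z {}sX {}sY {}sZ; apply/eqP; rewrite -subr_eq0; apply/eqP.
  have m1 := lc_metric lc sX sY sZ x0.
  rewrite (vf_deriv_induced si x0 sg sX sY sZ) in m1.
  have m2 := lc_metric lm (const_field_smooth p (X x0 *m J)) (const_field_smooth p (Y x0 *m J))
    (const_field_smooth p (Z x0 *m J)) p.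
  rewrite m2 !eval_induced /eval_form !const_field_at in m1.
  rewrite /q !eval_induced.
  move: m1; rewrite -/p -/J.
  set a := nabla D X Y x0; set b := nabla D X Z x0.
  set d1 := dpush i x0 X Y; set d2 := dpush i x0 X Z.
  set s := nabla Dm _ _ p; set t := nabla Dm _ _ p.
  set u := Y x0 *m J; set v := Z x0 *m J.
  clear m2; clearbody a b s t u v d1 d2.
  rewrite (form_atC u (b *m J) (symg p)) (form_atC u d2 (symg p)) (form_atC u t (symg p)).
  rewrite !form_atDl; lra.
Qed.

End Gauss2.

(** * Deforming a metric by a field of endomorphisms *)

Section Abstract.
Context {R : realType} {n : nat} (N : manifold R n).
Variables (ht : biform N) (mht : metric ht) (Dt : connection N) (lt : levi_civita ht Dt).
Variables (mu : N -> 'rV[R]_n -> 'rV[R]_n -> 'rV[R]_n) (F : N -> 'rV[R]_n -> 'rV[R]_n).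
Variables (k d : R).
Implicit Types (X Y Z U W : vfield N).
Hypothesis muC : forall x u v, mu x u v = mu x v u.
Hypothesis muCA : forall x u v w, mu x u (mu x v w) = mu x v (mu x u w).
Hypothesis mu_lin : forall x u, linear (mu x u).
Hypothesis mu_inv : forall x u v w,
  form_at (ht x) (mu x u v) w = form_at (ht x) v (mu x u w).
Hypothesis F_adj : forall x u v,
  form_at (ht x) (F x u) v + form_at (ht x) u (F x v) = d * form_at (ht x) u v.

Definition endo_app (P : N -> 'M[R]_n) (X : vfield N) : vfield N := fun x => X x *m P x.

(** When F is the derivative of the Euler field, this is the operator T of the
    weak F-manifold axioms, moved from 1-forms to vectors; Gmap is T - k. *)
Definition Tmap x u := ((d + k) / 2) *: u - F x u.

Definition Gmap x u := ((d - k) / 2) *: u - F x u.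

(** Prescribes the covariant derivative of P. This equation and the adjoint of
    F are all that the rest of the proof uses about the Euler field. It is
    insensitive to adding a constant multiple of the identity to P, which is
    how one equation serves the whole pencil. *)
Definition structure_eq (P : N -> 'M[R]_n) := forall X Y, smooth_vf X -> smooth_vf Y -> forall x,
  nabla Dt X (endo_app P Y) x - nabla Dt X Y x *m P x =
  k *: mu x (X x) (Y x) + F x (mu x (X x) (Y x)) - mu x (X x) (F x (Y x)).

Section Deformed.
Variables (P : N -> 'M[R]_n) (h : biform N) (D : connection N).
Hypothesis lc : levi_civita h D.
Hypothesis uP : forall x, P x \in unitmx.
Hypothesis hP : forall x, h x = invmx (P x) *m ht x.
Hypothesis P_adj : forall x u v, form_at (ht x) (u *m P x) v = form_at (ht x) u (v *m P x).
Hypothesis P_mu : forall x u v, mu x (u *m P x) v = mu x u v *m P x.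
Hypothesis P_smooth : forall X, smooth_vf X -> smooth_vf (endo_app P X).
Hypothesis P_eq : structure_eq P.

Let form_hl x u v : form_at (h x) (u *m P x) v = form_at (ht x) u v.
Proof. by rewrite /form_at hP !mulmxA mulmxK. Qed.

Let form_hr x u v : form_at (h x) u (v *m P x) = form_at (ht x) u v.
Proof.
have -> : u = (u *m invmx (P x)) *m P x by rewrite mulmxKV.
by rewrite form_hl -P_adj.
Qed.

Let muDr x u v w : mu x u (v + w) = mu x u v + mu x u w.
Proof. by have := mu_lin x u 1 v w; rewrite !scale1r. Qed.

Let mu0 x u : mu x u 0 = 0.
Proof. by apply: (addrI (mu x u 0)); rewrite -muDr !addr0. Qed.

Let muZr x u a v : mu x u (a *: v) = a *: mu x u v.
Proof. by have := mu_lin x u a v 0; rewrite mu0 !addr0. Qed.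

Let muNr x u v : mu x u (- v) = - mu x u v.
Proof. by rewrite -scaleN1r muZr scaleN1r. Qed.

(** V = X P^-1 is characterized by ht(V P, Y) = ht(X, Y) for all Y. *)
Lemma endo_app_inv_smooth X : smooth_vf X -> smooth_vf (endo_app (fun x => invmx (P x)) X).
Proof.
have [_ nd sm] := mht.
move=> sX; apply: (@solve_smooth _ _ N (fun x => P x *m ht x)).
- by move=> x; rewrite unitmx_mul uP nd.
- move=> Y Z sY sZ.
  have -> : eval_form (fun x => P x *m ht x) Y Z = eval_form ht (endo_app P Y) Z.
    by apply/funext => x; rewrite /eval_form /form_at /endo_app mulmxA.
  by apply: sm => //; exact: P_smooth.
- move=> Y sY.
  have -> : eval_form (fun x => P x *m ht x) (endo_app (fun x => invmx (P x)) X) Y = eval_form ht X Y.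
    by apply/funext => x; rewrite /eval_form /form_at /endo_app mulmxA mulmxKV.
  exact: sm.
Qed.

Lemma endo_appK X : endo_app P (endo_app (fun x => invmx (P x)) X) = X.
Proof. by apply/funext => x; rewrite /endo_app mulmxKV. Qed.

(** The right-hand side, as a connection acting on Y P, is metric for h and,
    once X is replaced with X P, torsion-free. The first fact uses the adjoint
    of F, the second one that mu (X P) Y is symmetric in X and Y. *)
Lemma deformed_nabla X Y : smooth_vf X -> smooth_vf Y -> forall x,
  nabla D X (endo_app P Y) x = nabla Dt X Y x *m P x + mu x (X x) (Tmap x (Y x)).
Proof.
have [sym nd sm] := mht.
pose e X Y x := nabla D X (endo_app P Y) x - (nabla Dt X Y x *m P x + mu x (X x) (Tmap x (Y x))).
(* P is onto on smooth fields, so the first argument may be taken of the form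
   X P, for which e is symmetric. *)
suff e0 X' Y' x : smooth_vf X' -> smooth_vf Y' -> e (endo_app P X') Y' x = 0.
  move=> sX sY x; apply/eqP; rewrite -subr_eq0; apply/eqP.
  have := e0 _ _ x (endo_app_inv_smooth sX) sY; rewrite endo_appK.
  by [].
move=> sX' sY'; apply: (@form_at_nondegenerate _ _ (ht x)) => // w.
have -> : form_at (ht x) 0 w = 0 by rewrite -(scale0r w) form_atZl mul0r.
rewrite -{1}(const_field_at x w).
pose q X Y Z := form_at (ht x) (e (endo_app P X) Y x) (Z x).
have sw := const_field_smooth x w.
apply: (@sym_skew_eq0 R _ (@smooth_vf _ _ N) q _ _ X' Y' (const_field x w)) => //.
- move=> X1 Y1 Z1 sX sY sZ; apply: (congr1 (form_at (ht x) ^~ (Z1 x))).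
  have sPX := P_smooth sX; have sPY := P_smooth sY.
  have b1 := lc_torsion_free lc sPX sPY x.
  have b2 := lc_torsion_free lt sPX sPY x.
  have s1 := P_eq sPX sY x; have s2 := P_eq sPY sX x.
  rewrite -b2 !fctE in b1.
  have {}b1 : nabla D (endo_app P X1) (endo_app P Y1) x - nabla D (endo_app P Y1) (endo_app P X1) x =
      nabla Dt (endo_app P X1) (endo_app P Y1) x - nabla Dt (endo_app P Y1) (endo_app P X1) x.
    exact: b1.
  rewrite /e /Tmap !muDr !muNr !muZr.
  have cm : mu x (endo_app P X1 x) (Y1 x) = mu x (endo_app P Y1 x) (X1 x).
    by rewrite /endo_app !P_mu muC.
  rewrite cm in s1 *.
  set a1 := nabla D _ _ x in b1 *; set a2 := nabla D _ _ x in b1 *.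
  set c1 := nabla Dt _ _ x in b1 s1; set c2 := nabla Dt _ _ x in b1 s2.
  set m1 := mu x _ (F x _) in s1 *; set m2 := mu x _ (F x _) in s2 *.
  set u1 := nabla Dt _ _ x *m _ in s1 *; set u2 := nabla Dt _ _ x *m _ in s2 *.
  set z := mu x _ _ in s1 s2 *.
  move: b1; rewrite -[c1](subrK u1) -[c2](subrK u2) s1 s2 => b1.
  rewrite -[a1](subrK a2) b1.
  by apply/rowP => j; rewrite !mxE; ring.
- move=> X1 Y1 Z1 sX sY sZ; rewrite /q /e.
  set W := endo_app P X1; have sW : smooth_vf W by exact: P_smooth.
  have sPY := P_smooth sY; have sPZ := P_smooth sZ.
  have m1 := lc_metric lc sW sPY sPZ x.
  have m2 := lc_metric lt sW sY sPZ x.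
  have ef : eval_form h (endo_app P Y1) (endo_app P Z1) = eval_form ht Y1 (endo_app P Z1).
    by apply/funext => y; rewrite /eval_form form_hl.
  rewrite ef {}m2 /eval_form form_hl form_hr in m1.
  have s2 := P_eq sW sZ x.
  rewrite /Tmap !muDr !muNr !muZr.
  have i1 := mu_inv x (W x) (F x (Y1 x)) (Z1 x).
  have i2 := mu_inv x (W x) (Y1 x) (Z1 x).
  have i3 := F_adj x (Y1 x) (mu x (W x) (Z1 x)).
  have i4 : form_at (ht x) (nabla Dt W Y1 x *m P x) (Z1 x) =
            form_at (ht x) (nabla Dt W Y1 x) (endo_app P Z1 x) by exact: P_adj.
  have i6 u : form_at (ht x) (Y1 x) u = form_at (ht x) u (Y1 x) by exact: form_atC (sym x).
  rewrite -[nabla Dt W (endo_app P Z1) x](subrK (nabla Dt W Z1 x *m P x)) s2 in m1.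
  rewrite !i6 in m1 i2 i3.
  rewrite !(form_atDl, form_atNl, form_atZl) in m1 *.
  have alg (a1 a2 v1 u1 u2 z Fm f1 f2 f3 ww : R) :
    v1 + (k * z + Fm - f3 + u2) = a1 + a2 ->
    f1 = ww -> f2 = z -> ww + Fm = d * z -> u1 = v1 ->
    a1 - (u1 + ((d + k) / 2 * f2 - f1)) = - (a2 - (u2 + ((d + k) / 2 * z - f3))).
    by move=> h1 -> -> h4 ->; lra.
  exact: alg m1 i1 i2 i3 i4.
Qed.

(** deformed_nabla for Y = U P^-1, minus the structure equation: the terms
    in which F acts on a factor of the product cancel, and what remains only
    depends on the product itself. *)
Lemma deformed_nabla_inv X U : smooth_vf X -> smooth_vf U -> forall x,
  nabla D X U x = nabla Dt X U x + Gmap x (mu x (X x) (U x *m invmx (P x))).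
Proof.
move=> sX sU x; have sV := endo_app_inv_smooth sU.
have e1 := deformed_nabla sX sV x; have e2 := P_eq sX sV x.
rewrite !endo_appK in e1 e2.
rewrite e1 /Gmap /Tmap -[nabla Dt X U x](subrK (nabla Dt X (endo_app (fun x => invmx (P x)) U) x *m P x)) e2.
rewrite /endo_app muDr muNr muZr.
set a := mu x _ (F x _); set b := mu x _ (_ *m _); set c := _ *m P x.
by apply/rowP => j; rewrite !mxE; field.
Qed.

Lemma muTmap_smooth X Z : smooth_vf X -> smooth_vf Z ->
  smooth_vf (fun x => mu x (X x) (Tmap x (Z x))).
Proof.
move=> sX sZ.
have -> : (fun x => mu x (X x) (Tmap x (Z x))) =
    nabla D X (endo_app P Z) - endo_app P (nabla Dt X Z).
  apply/funext => x; rewrite !fctE /= deformed_nabla// /endo_app.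
  by rewrite addrC addrA addNr add0r.
apply: smooth_vf_sub; first by apply: (nabla_smooth (lc_connection lc)) => //; exact: P_smooth.
by apply: P_smooth; exact: (nabla_smooth (lc_connection lt)).
Qed.

(** Multiplication and P^-1 commute, hence this is associativity. *)
Lemma mu_inv_comm x u v w :
  mu x u (mu x v w *m invmx (P x)) = mu x v (mu x u w *m invmx (P x)).
Proof.
have key a b : mu x a (b *m invmx (P x)) = mu x a b *m invmx (P x).
  by rewrite -[b in RHS](mulmxKV (uP x)) muC [in RHS]muC P_mu mulmxK.
by rewrite !key muCA.
Qed.

Lemma bracket_smooth X Y : smooth_vf X -> smooth_vf Y -> smooth_vf (bracket X Y).
Proof.
move=> sX sY; have <- : nabla Dt X Y - nabla Dt Y X = bracket X Y.
  by apply/funext => x; exact: (lc_torsion_free lt sX sY x).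
by apply: smooth_vf_sub; exact: (nabla_smooth (lc_connection lt)).
Qed.

Definition curvature (D' : connection N) (X Y Z : vfield N) : vfield N :=
  nabla D' X (nabla D' Y Z) - nabla D' Y (nabla D' X Z) - nabla D' (bracket X Y) Z.

(** The part of the curvature of the deformed connection that does not depend
    on P. *)
Definition curvature_defect (X Y Z : vfield N) : vfield N :=
  let U X := fun x => mu x (X x) (Tmap x (Z x)) in
  fun x => mu x (X x) (Tmap x (nabla Dt Y Z x)) + nabla Dt X (U Y) x
    - (mu x (Y x) (Tmap x (nabla Dt X Z x)) + nabla Dt Y (U X) x)
    - mu x (bracket X Y x) (Tmap x (Z x)).

(** In the second covariant derivative of Z P the only P-dependent term besides
    that of Dt is Gmap of a product that is symmetric in X and Y by
    mu_inv_comm, so it disappears from the curvature. *)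
Lemma deformed_curvature X Y Z : smooth_vf X -> smooth_vf Y -> smooth_vf Z -> forall x,
  curvature D X Y (endo_app P Z) x = curvature Dt X Y Z x *m P x + curvature_defect X Y Z x.
Proof.
move=> sX sY sZ x.
have sN (A B : vfield N) : smooth_vf A -> smooth_vf B -> smooth_vf (nabla Dt A B).
  exact: (nabla_smooth (lc_connection lt)).
have step (A B : vfield N) : smooth_vf A -> smooth_vf B ->
    nabla D A (nabla D B (endo_app P Z)) x =
    nabla Dt A (nabla Dt B Z) x *m P x + mu x (A x) (Tmap x (nabla Dt B Z x)) +
    (nabla Dt A (fun x => mu x (B x) (Tmap x (Z x))) x +
     Gmap x (mu x (A x) (mu x (B x) (Tmap x (Z x)) *m invmx (P x)))).
  move=> sA sB.
  have -> : nabla D B (endo_app P Z) =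
      endo_app P (nabla Dt B Z) + (fun x => mu x (B x) (Tmap x (Z x))).
    by apply/funext => y; rewrite deformed_nabla.
  rewrite (nabla_additive (lc_connection lc) sA (P_smooth (sN _ _ sB sZ)) (muTmap_smooth sB sZ)).
  rewrite !fctE /= deformed_nabla//; last exact: sN.
  by rewrite deformed_nabla_inv//; exact: muTmap_smooth.
rewrite /curvature !fctE /= (step X Y sX sY) (step Y X sY sX).
rewrite (deformed_nabla (bracket_smooth sX sY) sZ) (mu_inv_comm x (Y x) (X x)).
rewrite /curvature_defect mulmxBl mulmxBl.
set a1 := nabla Dt X (nabla Dt Y Z) x *m P x; set a2 := nabla Dt Y (nabla Dt X Z) x *m P x.
set a3 := nabla Dt (bracket X Y) Z x *m P x.
set G := Gmap x _.
set b1 := mu x _ (Tmap x (nabla Dt Y Z x)); set b2 := mu x _ (Tmap x (nabla Dt X Z x)).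
set c1 := nabla Dt X _ x; set c2 := nabla Dt Y _ x; set b3 := mu x _ _.
by apply/rowP => j; rewrite !mxE; ring.
Qed.

End Deformed.
End Abstract.

(** * Connections on 1-forms and index raising *)

Section Sharp.
Context {R : realType} {n : nat} (N : manifold R n).

Lemma pairing_sharp (G : biform N) (a : form1 N) (Y : vfield N) : nondegenerate_form G ->
  eval_form G (sharp G a) Y = pairing a Y.
Proof.
move=> nd; apply/funext => x; rewrite /eval_form /form_at /pairing /pair_at /sharp /sharp_at.
by rewrite mulmxKV// -trmx_mul mxE.
Qed.

(** A metric is parallel for its Levi-Civita connection, so raising indices
    commutes with covariant derivatives. *)
Lemma sharp_nabla1 (G : biform N) (D : connection N) (X : vfield N) (a : form1 N) :
  nondegenerate_form G -> levi_civita G D -> smooth_vf X -> smooth_form1 a ->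
  smooth_vf (sharp G a) ->
  sharp G (nabla1 D X a) = nabla D X (sharp G a).
Proof.
move=> nd lc sX sa sS; apply/funext => x; apply: (form_at_nondegenerate (nd x)) => w.
have sw := const_field_smooth x w.
have e1 := congr1 (fun f => f x) (pairing_sharp (nabla1 D X a) (const_field x w) nd).
rewrite /eval_form const_field_at in e1; rewrite e1.
rewrite (nabla1_dual (lc_connection lc) sX sa sw).
rewrite -!(pairing_sharp a _ nd) (lc_metric lc sX sS sw) addrK.
by rewrite /eval_form const_field_at.
Qed.

Lemma sharp_smooth (G : biform N) (a : form1 N) : metric G -> smooth_form1 a ->
  smooth_vf (sharp G a).
Proof.
move=> [_ nd sm] sa; apply: (solve_smooth nd sm) => Y sY.
by rewrite pairing_sharp//; exact: sa.
Qed.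

Lemma sharp_curvature1 (G : biform N) (D : connection N) (X Y : vfield N) (a : form1 N) :
  nondegenerate_form G -> levi_civita G D -> smooth_vf X -> smooth_vf Y ->
  smooth_vf (bracket X Y) -> smooth_form1 a -> smooth_vf (sharp G a) ->
  sharp G (curvature1 D X Y a) = curvature D X Y (sharp G a).
Proof.
move=> nd lc sX sY sb sa sS.
have sn (A B : vfield N) := nabla_smooth (lc_connection lc) (X := A) (Y := B).
have sn1 (A : vfield N) (B : form1 N) := nabla1_smooth (lc_connection lc) (X := A) (a := B).
have key (A B : vfield N) : smooth_vf A -> smooth_vf B ->
    sharp G (nabla1 D A (nabla1 D B a)) = nabla D A (nabla D B (sharp G a)).
  move=> sA sB; rewrite -(sharp_nabla1 nd lc sB sa sS) sharp_nabla1//; first exact: sn1.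
  by rewrite sharp_nabla1//; exact: sn.
rewrite /curvature -(key _ _ sX sY) -(key _ _ sY sX) -(sharp_nabla1 nd lc sb sa sS).
by apply/funext => x; rewrite /sharp /sharp_at /curvature1 !fctE /= !linearB /= !mulmxBl.
Qed.

End Sharp.

(** * Weak F-manifolds *)

Section Tensoriality.
Context {R : realType} {m : nat} (M : manifold R m).

Lemma smooth_map_id : smooth_map (@id M).
Proof.
split; first by move=> x A; exact.
by move=> c c' ac ac'; exact: atlas_smooth ac ac'.
Qed.

Lemma tangent_map_id x : tangent_map (@id M) x = 1%:M.
Proof. exact: jacobian_trans_id (chart_at_atlas x) (chart_at_img x). Qed.

Lemma induced_metric_id (g : biform M) : induced_metric (@id M) g = g.
Proof.
by apply/funext => x; rewrite /induced_metric tangent_map_id mul1mx trmx1 mulmx1.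
Qed.

(** The Gauss formula for the identity map of M expresses the covariant
    derivative at p through X p. *)
Lemma nabla_local (gt : biform M) (D : connection M) (X X' Y : vfield M) p :
  metric gt -> levi_civita gt D -> smooth_vf X -> smooth_vf X' -> smooth_vf Y ->
  X p = X' p -> nabla D X Y p = nabla D X' Y p.
Proof.
move=> mg lc sX sX' sY e; have [_ nd _] := mg.
have lc' : levi_civita (induced_metric (@id M) gt) D by rewrite induced_metric_id.
apply: (form_at_nondegenerate (nd p)) => w.
have g1 := gauss smooth_map_id mg lc lc' p sX sY (const_field_smooth p w).
have g2 := gauss smooth_map_id mg lc lc' p sX' sY (const_field_smooth p w).
rewrite /dpush /= e in g1; rewrite /dpush /= in g2.
by have := etrans g1 (esym g2); rewrite induced_metric_id /eval_form const_field_at.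
Qed.

End Tensoriality.

Section WeakF.
Context {R : realType} {m : nat} (M : manifold R m).
Variables (mul : multiplication M) (E : vfield M) (gt : biform M) (k d : R).
Variables (e Einv : vfield M) (D : connection M).
Hypothesis wF : weak_F_axioms mul E gt k d e Einv D.
Implicit Types (X Y Z : vfield M).

Let mg := wF_gt wF.
Let lc := wF_D wF.
Let sE := wF_E wF.
Let smul := mul_smooth (wF_mul wF).
Lemma wF_inv x u v w : form_at (gt x) (mul x u v) w = form_at (gt x) u (mul x v w).
Proof.
have := wF_invariant wF (const_field_smooth x u) (const_field_smooth x v) (const_field_smooth x w) x.
by rewrite /eval_form /mulv !const_field_at.
Qed.

Lemma wF_mulBr x u v w : mul x u (v - w) = mul x u v - mul x u w.
Proof.
have l := mul_linearr (wF_mul wF) x u.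
by rewrite addrC -scaleN1r l scaleN1r addrC.
Qed.

(** Paired with Z, and after E is moved by the invariance of gt, the left-hand
    side becomes nabla(mul)(X, Y, Z, E) up to a derivative of E. The symmetry
    axiom replaces it with the derivative of the multiplication in the direction
    E, which is known from the Lie derivative of the multiplication along E. *)
Lemma nabla_mulE X Y : smooth_vf X -> smooth_vf Y -> forall x,
  nabla D X (mulv mul E Y) x - mul x (E x) (nabla D X Y x) =
  k *: mul x (X x) (Y x) + nabla D (mulv mul X Y) E x - mul x (X x) (nabla D Y E x).
Proof.
move=> sX sY x; have [sym nd sm] := mg.
apply: (form_at_nondegenerate (nd x)) => w; rewrite -(const_field_at x w).
set Z := const_field x w; have sZ : smooth_vf Z by exact: const_field_smooth.
have m1 := lc_metric lc sX (smul sE sY) sZ x.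
have m2 := lc_metric lc sX sE (smul sY sZ) x.
have ef : eval_form gt (mulv mul E Y) Z = eval_form gt E (mulv mul Y Z).
  by apply/funext => y; rewrite /eval_form /mulv wF_inv.
rewrite ef {}m2 /eval_form in m1.
have c4 := wF_nabla_mul wF sX sY sZ x.
rewrite /nabla_mul4 /eval_form in c4.
have t1 := lc_torsion_free lc sE (smul sX sY) x.
have t2 := lc_torsion_free lc sE sX x.
have t3 := lc_torsion_free lc sE sY x.
have l1 := wF_lie_mul wF sX sY x.
have mulC := wF_mulC wF x.
have e1 : nabla_mul D mul E X Y x = k *: mul x (X x) (Y x) + nabla D (mulv mul X Y) E x
   - mul x (nabla D X E x) (Y x) - mul x (X x) (nabla D Y E x).
  move: t1 t2 t3 l1; rewrite /nabla_mul !fctE /= /mulv => t1 t2 t3.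
  rewrite -t1 -t2 -t3 !wF_mulBr (mulC _ (Y x)) (mulC (nabla D X E x)) wF_mulBr => l1.
  rewrite (mulC _ (Y x)).
  rewrite -l1.
  apply/rowP => j; rewrite !mxE; ring.
rewrite e1 /nabla_mul !fctE /= in c4.
move: c4 m1; rewrite !(form_atBl, form_atDl) /=.
have i1 := wF_inv x (nabla D X E x) (Y x) (Z x).
have i2 : form_at (gt x) (mulv mul E Y x) (nabla D X Z x) =
  form_at (gt x) (mulv mul Y (nabla D X Z) x) (E x).
  by rewrite /mulv wF_inv; exact: form_atC (sym x).
have i3 : form_at (gt x) (mul x (E x) (nabla D X Y x)) (Z x) =
  form_at (gt x) (mulv mul (nabla D X Y) Z x) (E x).
  by rewrite /mulv wF_inv; exact: form_atC (sym x).
have i4 := form_atC (E x) (nabla D X (mulv mul Y Z) x) (sym x).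
have alg (a b c n n' K N T L a' c' b' : R) : n = n' -> c' = c -> b' = b -> a' = a ->
  a - b - c = K + N - n - T -> n' + a' = L + c' -> L - b' = K + N - T.
  by move=> <- -> -> ->; lra.
exact: alg i1 i2 i3 i4.
Qed.

(** The conformal Killing equation for E, rewritten with nabla. *)
Lemma nabla_E_skew X Y : smooth_vf X -> smooth_vf Y -> forall x,
  form_at (gt x) (nabla D X E x) (Y x) + form_at (gt x) (X x) (nabla D Y E x) =
  d * form_at (gt x) (X x) (Y x).
Proof.
move=> sX sY x.
have l := wF_lie_gt wF sX sY x.
have mt := lc_metric lc sE sX sY x.
have t2 := lc_torsion_free lc sE sX x.
have t3 := lc_torsion_free lc sE sY x.
rewrite mt /eval_form -t2 -t3 !fctE /= in l.
rewrite -l !(form_atDl, form_atDr, form_atNl, form_atNr).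
have alg (a b c f : R) : c + f = a + b - (a - c) - (b - f) by ring.
exact: alg.
Qed.

(** The covariant derivative of E as an operator on tangent vectors; by
    nabla_local the choice of the extension of u is immaterial. *)
Definition nablaE p u : 'rV[R]_m := nabla D (const_field p u) E p.

Lemma nablaE_field X p : smooth_vf X -> nabla D X E p = nablaE p (X p).
Proof.
by move=> sX; apply: (nabla_local mg lc sX (const_field_smooth p _) sE); rewrite const_field_at.
Qed.

Lemma nablaE_skew p u v : form_at (gt p) (nablaE p u) v + form_at (gt p) u (nablaE p v) =
  d * form_at (gt p) u v.
Proof.
by have := nabla_E_skew (const_field_smooth p u) (const_field_smooth p v) p; rewrite !const_field_at.
Qed.

(** * Restriction to the submanifold *)

Section Restrict.
Context {n : nat} (N : manifold R n).
Variables (i : N -> M) (Hi : submanifold i).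
Hypothesis HTN : forall (x : N) (u v : 'rV[R]_m),
  tangent_to i x u -> tangent_to i x v -> tangent_to i x (mul (i x) u v).
Hypothesis HETN : forall (x : N) (u : 'rV[R]_m),
  tangent_to i x u -> tangent_to i x (mul (i x) (E (i x)) u).
Variables (g : biform M) (mg' : metric g).
Hypothesis HgE : forall (x : M) (v : 'rV[R]_m),
  sharp_at (g x) (lower_at (gt x) v) = mul x (E x) v.
Let h := induced_metric i g.
Let ht := induced_metric i gt.
Hypothesis nh : nondegenerate_form h.
Hypothesis nht : nondegenerate_form ht.
Let J x := tangent_map i x.

(** The pseudo-inverse recovers a vector from its image under the injective
    tangent map; the product of tangent vectors is such an image. *)
Definition mul_sub (x : N) (u v : 'rV[R]_n) : 'rV[R]_n :=
  mul (i x) (u *m J x) (v *m J x) *m pinvmx (J x).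

(** On the tangent spaces of N the endomorphism ht h^-1 is the multiplication
    by E, by mulE_sub_J, although E itself need not be tangent to N. *)
Definition mulE_sub (x : N) : 'M[R]_n := ht x *m invmx (h x).

(** The tangential part of the derivative of E, that is, the vector whose
    ht-product with v is the gt-product of nablaE (i_* u) with i_* v. *)
Definition nablaE_sub (x : N) (u : 'rV[R]_n) : 'rV[R]_n :=
  nablaE (i x) (u *m J x) *m gt (i x) *m (J x)^T *m invmx (ht x).

Let free_J x : row_free (J x).
Proof. by case: Hi => _ _; apply. Qed.

Let J_inj x (u v : 'rV[R]_n) : u *m J x = v *m J x -> u = v.
Proof. exact: (row_free_inj (free_J x)). Qed.

Let pinvK x w : tangent_to i x w -> w *m pinvmx (J x) *m J x = w.
Proof. by move=> [v ->]; rewrite -/(J x) (mulmxKp (free_J x)). Qed.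

Lemma form_sub_gt x u v : form_at (ht x) u v = form_at (gt (i x)) (u *m J x) (v *m J x).
Proof. by rewrite /form_at /ht /induced_metric trmx_mul !mulmxA. Qed.

Lemma mul_sub_J x u v : mul_sub x u v *m J x = mul (i x) (u *m J x) (v *m J x).
Proof. by apply: pinvK; apply: HTN; eexists. Qed.

Lemma mulE x v : mul x (E x) v = v *m gt x *m invmx (g x).
Proof. by rewrite -HgE /sharp_at /lower_at trmxK. Qed.

(** The tangent vector E . i_* u has h-products equal to the ht-products of
    u. *)
Lemma mulE_sub_J x u : u *m mulE_sub x *m J x = mul (i x) (E (i x)) (u *m J x).
Proof.
have [_ ng _] := mg'.
have [w ew] : tangent_to i x (mul (i x) (E (i x)) (u *m J x)) by apply: HETN; eexists.
rewrite ew -/(J x); congr (_ *m _).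
have : w *m h x = u *m ht x.
  rewrite /h /ht /induced_metric -/(J x) !mulmxA -ew mulE mulmxKV ?ng//.
by move=> eh; rewrite /mulE_sub mulmxA -eh mulmxK.
Qed.

Lemma form_nablaE_sub x u v :
  form_at (ht x) (nablaE_sub x u) v = form_at (gt (i x)) (nablaE (i x) (u *m J x)) (v *m J x).
Proof. by rewrite /form_at /nablaE_sub mulmxKV// trmx_mul !mulmxA. Qed.

Lemma sub_gt_sym x : (ht x)^T = ht x.
Proof. by have [sym _ _] := mg; rewrite /ht /induced_metric !trmx_mul trmxK sym mulmxA. Qed.

Lemma mul_subC x u v : mul_sub x u v = mul_sub x v u.
Proof. by rewrite /mul_sub (wF_mulC wF). Qed.

Lemma mul_subCA x u v w : mul_sub x u (mul_sub x v w) = mul_sub x v (mul_sub x u w).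
Proof.
apply: (@J_inj x); rewrite !mul_sub_J.
by rewrite (wF_mulA wF) (wF_mulC wF _ (u *m _)) -(wF_mulA wF).
Qed.

Lemma mul_sub_linear x u : linear (mul_sub x u).
Proof.
move=> a v w; have l := mul_linearr (wF_mul wF) (i x) (u *m J x).
by rewrite /mul_sub mulmxDl -scalemxAl l mulmxDl -scalemxAl.
Qed.

Lemma mul_sub_inv x u v w :
  form_at (ht x) (mul_sub x u v) w = form_at (ht x) v (mul_sub x u w).
Proof. by rewrite mul_subC !form_sub_gt !mul_sub_J wF_inv. Qed.

Lemma nablaE_sub_adj x u v :
  form_at (ht x) (nablaE_sub x u) v + form_at (ht x) u (nablaE_sub x v) = d * form_at (ht x) u v.
Proof.
rewrite form_nablaE_sub (form_atC u _ (sub_gt_sym x)) form_nablaE_sub form_sub_gt -nablaE_skew.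
by have [sym _ _] := mg; congr (_ + _); exact: form_atC.
Qed.

Lemma mulE_sub_adj x u v : form_at (ht x) (u *m mulE_sub x) v = form_at (ht x) u (v *m mulE_sub x).
Proof.
by rewrite !form_sub_gt !mulE_sub_J (wF_mulC wF) wF_inv.
Qed.

Lemma mulE_sub_mul x u v : mul_sub x (u *m mulE_sub x) v = mul_sub x u v *m mulE_sub x.
Proof. by apply: (@J_inj x); rewrite mulE_sub_J !mul_sub_J mulE_sub_J (wF_mulA wF). Qed.

Lemma sub_gt_metric : metric ht.
Proof.
have [sym _ sm] := mg; have [si _ _] := Hi; split; [exact: sub_gt_sym|exact: nht|].
exact: induced_smooth.
Qed.

Lemma sub_g_smooth : smooth_biform h.
Proof.
have [_ _ sm] := mg'; have [si _ _] := Hi; exact: induced_smooth.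
Qed.

Lemma mulE_sub_smooth (Y : vfield N) : smooth_vf Y -> smooth_vf (endo_app mulE_sub Y).
Proof.
move=> sY; have [_ _ sm] := sub_gt_metric.
apply: (solve_smooth nh sub_g_smooth) => Z sZ.
have -> : eval_form h (endo_app mulE_sub Y) Z = eval_form ht Y Z; last exact: sm.
by apply/funext => x; rewrite /eval_form /form_at /endo_app /mulE_sub mulmxA mulmxKV.
Qed.

(** The restriction to N of nabla_mulE. By the Gauss formula both sides are
    compared with ambient derivatives; normal components are harmless because
    the product of a normal vector with a tangent vector, or with E, is
    orthogonal to N by the invariance of gt. *)
Lemma mulE_sub_structure (Dt : connection N) : levi_civita ht Dt ->
  structure_eq Dt mul_sub nablaE_sub k mulE_sub.
Proof.
move=> lt XN YN sX sY x; have [si _ _] := Hi; have [sym nd sm] := mg.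
apply: (form_at_nondegenerate (nht x)) => w; rewrite -(const_field_at x w).
set ZN := const_field x w; have sZ : smooth_vf ZN by exact: const_field_smooth.
(* B u v = gt (E . u) v, so that ht (A Y, Z) is the form induced by B. *)
pose B : biform M := fun x => gt x *m invmx (g x) *m gt x.
have BE y u v : form_at (B y) u v = form_at (gt y) (mul y (E y) u) v.
  by rewrite /form_at /B mulE !mulmxA.
have sB : smooth_biform B.
  move=> A C sA sC; have -> : eval_form B A C = eval_form gt (mulv mul E A) C.
    by apply/funext => y; rewrite /eval_form BE.
  by apply: sm => //; exact: smul.
have sAY := mulE_sub_smooth sY.
have m1 := lc_metric lt sX sAY sZ x.
have ef : eval_form ht (endo_app mulE_sub YN) ZN = eval_form (induced_metric i B) YN ZN.
  by apply/funext => y; rewrite eval_induced BE /eval_form form_sub_gt mulE_sub_J.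
rewrite {}ef (vf_deriv_induced si x sB sX sY sZ) !BE in m1.
have g1 := gauss si mg lc lt x sX sZ sAY.
have g2 := gauss si mg lc lt x sX sY (mulE_sub_smooth sZ).
rewrite -/(J x) in m1 g1 g2.
have sXh := const_field_smooth (i x) (XN x *m J x).
have sYh := const_field_smooth (i x) (YN x *m J x).
have sZh := const_field_smooth (i x) (ZN x *m J x).
have eB : eval_form B (const_field (i x) (YN x *m J x)) (const_field (i x) (ZN x *m J x)) =
  eval_form gt (mulv mul E (const_field (i x) (YN x *m J x))) (const_field (i x) (ZN x *m J x)).
  by apply/funext => y; rewrite /eval_form BE.
rewrite {}eB (lc_metric lc sXh (smul sE sYh) sZh) /eval_form /mulv !const_field_at in m1.
have v1 := nabla_mulE sXh sYh (i x).
rewrite !(nablaE_field (i x)) ?const_field_at in v1; [|exact: sYh|exact: smul].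
rewrite /mulv !const_field_at in v1.
have {}v1 := congr1 (form_at (gt (i x)) ^~ (ZN x *m J x)) v1.
rewrite /= !(form_atBl, form_atDl, form_atZl) in v1.
have eE u z : form_at (gt (i x)) u (mul (i x) (E (i x)) z) =
   form_at (gt (i x)) (mul (i x) (E (i x)) u) z.
  by rewrite (wF_mulC wF _ _ u) wF_inv.
rewrite /eval_form -/ht /= [endo_app mulE_sub YN x *m J x]mulE_sub_J form_atDl in g1.
rewrite /eval_form -/ht /= [endo_app mulE_sub ZN x *m J x]mulE_sub_J form_atDl !eE in g2.
rewrite (form_atC _ _ (sub_gt_sym x)) in g1.
have sC u z := form_atC u z (sym (i x)).
rewrite (sC (dpush i x XN ZN)) (sC (nabla D _ (const_field (i x) (ZN x *m J x)) (i x))) in g1.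
rewrite !(form_atDl, form_atNl, form_atZl) mulE_sub_adj.
rewrite (mul_sub_inv x (XN x) (nablaE_sub x (YN x))) !form_nablaE_sub.
rewrite (form_sub_gt x (mul_sub x (XN x) (YN x))) !mul_sub_J.
rewrite -[form_at (gt (i x)) (nablaE (i x) (YN x *m J x)) _]wF_inv.
rewrite (wF_mulC wF _ (nablaE (i x) (YN x *m J x))).
have alg (p1 q1 L q2 u b b' c r K : R) : p1 + q1 + (L + q2) = u + b ->
  b = q1 + q2 -> c = p1 + r -> L - r = K -> u - c = K.
  by move=> h1 h2 h3 h4; lra.
exact: alg m1 g1 g2 v1.
Qed.

End Restrict.
End WeakF.

(** * Compatibility of the induced metrics *)

Theorem proposition29 (R : realType) (m n : nat)
    (M : manifold R m) (mul : multiplication M) (E : vfield M)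
    (gt : biform M) (k D : R)
    (HM : weak_F_manifold mul E gt k D)
    (g : biform M) (Hg : metric g)
    (HgE : forall (x : M) (v : 'rV[R]_m),
       sharp_at (g x) (lower_at (gt x) v) = mul x (E x) v)
    (N : manifold R n) (i : N -> M) (Hi : submanifold i)
    (HTN : forall (x : N) (u v : 'rV[R]_m),
       tangent_to i x u -> tangent_to i x v ->
       tangent_to i x (mul (i x) u v))
    (HETN : forall (x : N) (u : 'rV[R]_m),
       tangent_to i x u -> tangent_to i x (mul (i x) (E (i x)) u))
    (Hpencil : forall lambda : R, nondegenerate_form (dual_pencil g gt lambda))
    (Hh : nondegenerate_form (induced_metric i g))
    (Hht : nondegenerate_form (induced_metric i gt))
    (Hhpencil : forall lambda : R,
       nondegenerate_form (dual_pencil (induced_metric i g) (induced_metric i gt) lambda)) :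
  compatible (induced_metric i g) (induced_metric i gt).
Proof.
case: HM => e [Einv [Dm wF]].
set h := induced_metric i g in Hh Hhpencil *.
set ht := induced_metric i gt in Hht Hhpencil *.
have mht : metric ht := sub_gt_metric wF Hi Hht.
have muC := mul_subC wF i.
have muCA := mul_subCA wF Hi HTN.
have mul_lin := mul_sub_linear wF i.
have mu_inv := mul_sub_inv wF Hi HTN.
have F_adj := nablaE_sub_adj wF Hht.
have A_adj := mulE_sub_adj wF HETN Hg HgE Hh.
have A_mul := mulE_sub_mul wF Hi HTN HETN Hg HgE Hh.
have A_smooth := mulE_sub_smooth wF Hi Hg Hh Hht.
pose A := mulE_sub gt i g.
pose P lam (x : N) : 'M[R]_n := A x + lam *: 1%:M.
have uA x : A x \in unitmx by rewrite unitmx_mul Hht unitmx_inv Hh.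
have uPe lam x : P lam x = ht x *m dual_pencil h ht lam x.
  by rewrite /P /dual_pencil mulmxDr -scalemxAr mulmxV.
have uP lam x : P lam x \in unitmx by rewrite uPe unitmx_mul Hht Hhpencil.
have hA x : h x = invmx (A x) *m ht x.
  by rewrite -[LHS]mul1mx -(mulVmx (uA x)) -mulmxA {2}/A /mulE_sub mulmxKV.
have hP lam x : pencil h ht lam x = invmx (P lam x) *m ht x.
  rewrite /pencil; apply: (can_inj (mulKmx (uP lam x))).
  by rewrite mulKVmx ?uP// uPe mulmxK ?Hhpencil.
have appP lam X : endo_app (P lam) X = endo_app A X + scalev (fun=> lam) X.
  by apply/funext => x; rewrite /endo_app /scalev !fctE /P mulmxDr -scalemxAr mulmx1.
have P_adj lam x u v : form_at (ht x) (u *m P lam x) v = form_at (ht x) u (v *m P lam x).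
  rewrite /P !mulmxDr -!scalemxAr !mulmx1 form_atDl form_atDr form_atZl form_atZr.
  by rewrite A_adj.
have P_mul lam x u v : mul_sub mul i x (u *m P lam x) v = mul_sub mul i x u v *m P lam x.
  rewrite /P !mulmxDr -!scalemxAr !mulmx1 -A_mul.
  by rewrite muC addrC mul_lin addrC muC (muC x v).
have P_smooth lam X : smooth_vf X -> smooth_vf (endo_app (P lam) X).
  move=> sX; rewrite appP; apply: smooth_vf_add; first exact: A_smooth.
  by apply: smooth_vf_scale => //; exact: smooth_fun_cst.
have A_eq := mulE_sub_structure wF Hi HTN HETN Hg HgE Hh Hht.
have P_eq lam Dt : levi_civita ht Dt ->
    structure_eq Dt (mul_sub mul i) (nablaE_sub E gt Dm i) k (P lam).
  move=> lt X Y sX sY x; rewrite -(A_eq Dt lt X Y sX sY x) appP.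
  have sc := @smooth_fun_cst _ _ N lam.
  rewrite (nabla_additive (lc_connection lt) sX (A_smooth _ sY) (smooth_vf_scale sc sY)).
  rewrite fctE /= (nabla_leibniz (lc_connection lt) sc sX sY) fctE /= /scalev /P.
  rewrite /vf_deriv (_ : (fun=> lam) \o _ = cst lam)// derive_cst scale0r add0r.
  by rewrite mulmxDr -scalemxAr mulmx1 opprD addrACA subrr addr0.
have ndP lam : nondegenerate_form (pencil h ht lam).
  by move=> x; rewrite /pencil unitmx_inv Hhpencil.
have sharp_ht a : smooth_form1 a -> smooth_vf (sharp ht a) by exact: sharp_smooth.
have sharp_h a : sharp h a = endo_app A (sharp ht a).
  by apply/funext => x; rewrite /sharp /sharp_at /endo_app /A /mulE_sub mulmxA mulmxKV.
have sharp_P lam a : sharp (pencil h ht lam) a = endo_app (P lam) (sharp ht a).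
  apply/funext => x; rewrite /sharp /sharp_at /endo_app uPe mulmxA mulmxKV//.
  by rewrite /pencil invmxK.
split.
  move=> lam Dh Dt Dl lh lt ll X a sX sa x.
  have sZ := sharp_ht a sa.
  have sPZ := P_smooth lam _ sZ; have sAZ := A_smooth _ sZ.
  rewrite !fctE /= -sharp_P in sPZ *; rewrite -sharp_h in sAZ.
  rewrite (sharp_nabla1 (ndP lam) ll sX sa sPZ) (sharp_nabla1 Hh lh sX sa sAZ).
  rewrite (sharp_nabla1 Hht lt sX sa sZ) sharp_P sharp_h.
  rewrite (deformed_nabla mht lt muC mul_lin mu_inv F_adj ll (uP lam) (hP lam)
    (P_adj lam) (P_mul lam) (P_smooth lam) (P_eq lam Dt lt) sX sZ).
  rewrite (deformed_nabla mht lt muC mul_lin mu_inv F_adj lh uA hA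
    A_adj A_mul A_smooth (A_eq Dt lt) sX sZ).
  by rewrite /P mulmxDr -scalemxAr mulmx1 addrAC.
move=> lam Dh Dt Dl lh lt ll X Y a sX sY sa x.
have sZ := sharp_ht a sa.
have sPZ := P_smooth lam _ sZ; have sAZ := A_smooth _ sZ.
have sb := bracket_smooth lt sX sY.
rewrite !fctE /= -sharp_P in sPZ *; rewrite -sharp_h in sAZ.
rewrite (sharp_curvature1 (ndP lam) ll sX sY sb sa sPZ) (sharp_curvature1 Hh lh sX sY sb sa sAZ).
rewrite (sharp_curvature1 Hht lt sX sY sb sa sZ) sharp_P sharp_h.
rewrite (deformed_curvature mht lt muC muCA mul_lin mu_inv F_adj ll (uP lam) (hP lam)
  (P_adj lam) (P_mul lam) (P_smooth lam) (P_eq lam Dt lt) sX sY sZ).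
rewrite (deformed_curvature mht lt muC muCA mul_lin mu_inv F_adj lh uA hA
  A_adj A_mul A_smooth (A_eq Dt lt) sX sY sZ).
by rewrite /P mulmxDr -scalemxAr mulmx1 addrAC.
Qed.
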